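(* Let $X,Y$ be independent, almost surely finite real-valued random variables with $p=P(X<Y)>0$ and $q=P(X>Y)>0$, and denote $r=P(X=Y)$. Then time and cause are independent for $X,Y$ if and only if there is a strictly increasing function $g:(0,\infty)\to\mathbb{R}$ such that the distributions of $X$ and $Y$ (hence also that of $X\wedge Y$) are either all $g$-exponential (when $r=0$) or all $g$-geometric (when $r>0$), with the same $g$ for all of them.
   Context: Notation: $x\wedge y=\min(x,y)$, and $\sim$ means ''distributed as''. A random variable $Z$ is independent of an event $A$ if $P(\{Z\le t\}\cap A)=P(Z\le t)P(A)$ for all $t\in\mathbb{R}$. For random variables $X,Y$, ''time and cause are independent'' means that the random variable $X\wedge Y$ is independent of each of the events $\{X>Y\}$, $\{X<Y\}$ and $\{X=Y\}$. For a function $g:(0,\infty)\to\mathbb{R}$, a random variable $X$ has a $g$-exponential distribution if $X\sim g(V)$ where $V$ is exponentially distributed with some rate $\lambda>0$; it has a $g$-geometric distribution if $X\sim g(V)$ where $V$ is geometrically distributed on $\{1,2,\ldots\}$ with some success parameter $\alpha\in(0,1)$, i.e. $P(V=k)=\alpha(1-\alpha)^{k-1}$ for $k\ge 1$. When several random variables are said to have $g$-exponential (resp. $g$-geometric) distributions, the parameters $\lambda$ (resp. $\alpha$) may differ between them, but $g$ is the same for all. *)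

(* Defs.v *)
From mathcomp Require Import all_boot all_order all_algebra.
From mathcomp Require Import all_classical all_reals all_analysis.
From mathcomp Require Import measurable_realfun.

Set Implicit Arguments.
Unset Strict Implicit.
Unset Printing Implicit Defensive.

Import Order.TTheory GRing.Theory Num.Theory.
Import numFieldNormedType.Exports.

Local Open Scope classical_set_scope.
Local Open Scope ring_scope.
Local Open Scope ereal_scope.

Section TimeAndCause.
Context d (T : measurableType d) (R : realType) (P : probability T R).

(* Random variables are extended-real-valued functions, so that "almost surely
   finite" is a genuine hypothesis. *)

Definition independent_rv (X Y : T -> \bar R) : Prop :=
  forall A B : set (\bar R), measurable A -> measurable B ->
    P (X @^-1` A `&` Y @^-1` B) = P (X @^-1` A) * P (Y @^-1` B).

Definition as_finite (X : T -> \bar R) : Prop :=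
  {ae P, forall w, X w \is a fin_num}.

Definition rv_min (X Y : T -> \bar R) : T -> \bar R :=
  fun w => Order.min (X w) (Y w).

Definition indep_of_event (Z : T -> \bar R) (A : set T) : Prop :=
  forall t : R,
    P ([set w | Z w <= t%:E] `&` A) = P [set w | Z w <= t%:E] * P A.

Definition time_cause_independent (X Y : T -> \bar R) : Prop :=
  [/\ indep_of_event (rv_min X Y) [set w | X w > Y w],
      indep_of_event (rv_min X Y) [set w | X w < Y w]
    & indep_of_event (rv_min X Y) [set w | X w = Y w] ].

End TimeAndCause.

Section GDistributions.
Context (R : realType).

(* A function (0, oo) -> R is represented by a total function whose values
   outside of (0, oo) are never used. *)
Definition strictly_increasing_pos (g : R -> R) : Prop :=
  forall u v : R, (0 < u)%R -> (u < v)%R -> (g u < g v)%R.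

(* The law of g(V), on the extended line, when V has law [mu]; meant for [mu]
   concentrated on (0, oo). *)
Definition image_law (g : R -> R) (mu : set R -> \bar R) :
    set (\bar R) -> \bar R :=
  fun B => mu [set v | (0 < v)%R /\ B (g v)%:E].

Definition geometric_prob (alpha : R) : set R -> \bar R :=
  fun A => \sum_(1 <= k <oo) (alpha * (1 - alpha) ^+ k.-1)%:E * \d_(k%:R : R) A.

Context d (T : measurableType d) (P : probability T R).

Definition g_exponential (g : R -> R) (Z : T -> \bar R) : Prop :=
  exists2 lambda : R, (0 < lambda)%R &
    forall B : set (\bar R), measurable B ->
      P (Z @^-1` B) = image_law g (exponential_prob lambda) B.

Definition g_geometric (g : R -> R) (Z : T -> \bar R) : Prop :=
  exists2 alpha : R, (0 < alpha < 1)%R &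
    forall B : set (\bar R), measurable B ->
      P (Z @^-1` B) = image_law g (geometric_prob alpha) B.

End GDistributions.

(* Main.v *)
(* Let F, G and H = F G be the tail functions of X, Y and Z = min(X, Y). For
   s <= t, independence of X and Y gives
     G t (F s - F t) <= P(s < Z <= t, X < Y) <= G s (F s - F t),
   and the middle term is p (H s - H t) when time and cause are independent.
   If r = 0, then Z has no atom, and summing these bounds over finer and finer
   partitions forces F = H ^ p and G = H ^ q; hence g v is the point where H
   takes the value exp(- v). Read backwards, the same bounds give the converse.
   If r > 0, combining them with r (H s - H t) <= (F s - F t) (G s - G t) shows
   that either H t = H s or H t <= kappa H s with kappa = p q / (p q + r) < 1.
   So Z lives on an increasing sequence of atoms; at each of them F is
   multiplied by q / (q + r) and G by p / (p + r), and g interpolates the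
   sequence. Conversely, when both laws live on g 1 < g 2 < ..., the masses of
   {Z = g k, X < Y}, {Z = g k, X > Y}, {Z = g k, X = Y} are proportional to
   P(Z = g k) with ratios that do not depend on k. *)

Require Import Defs.
From mathcomp Require Import all_boot all_order all_algebra.
From mathcomp Require Import all_classical all_reals all_analysis.
From mathcomp Require Import measurable_realfun.
From mathcomp Require Import ring lra.

Set Implicit Arguments.
Unset Strict Implicit.
Unset Printing Implicit Defensive.

Import Order.TTheory GRing.Theory Num.Theory.
Import numFieldNormedType.Exports.

Local Open Scope classical_set_scope.
Local Open Scope ring_scope.

(** * Real analysis *)

(** The inequality [1 - x <= expR (- x)] multiplied by [expR x]. *)
Lemma expR_sub1_le (R : realType) (x : R) : expR x - 1 <= x * expR x.
Proof.
have := expR_ge1Dx (- x).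
rewrite -(ler_pM2r (expR_gt0 x)) mulrDl mul1r expRN mulVf ?gt_eqF ?expR_gt0//.
by rewrite mulNr => ?; lra.
Qed.

(* Over [n] equal steps the factor [expR (K * (t - s))] becomes
   [expR (K * (t - s) / n)], which tends to 1. *)
Lemma increment_bound (R : realType) (h k : R -> R) (c K : R) :
  (forall s t : R, 0 <= s -> s <= t ->
     h t - h s <= c * expR (K * (t - s)) * (k t - k s)) ->
  forall s t : R, 0 <= s -> s <= t -> h t - h s <= c * (k t - k s).
Proof.
move=> hk s t s0 st.
have step n : h t - h s <= c * (k t - k s) * expR (K * (t - s) * n.+1%:R^-1).
  pose x i : R := s + (t - s) * (i%:R / n.+1%:R).
  have x0 : x 0%N = s by rewrite /x mul0r mulr0 addr0.
  have xn : x n.+1 = t by rewrite /x divff ?pnatr_eq0// mulr1 addrC subrK.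
  have dx i : x i.+1 - x i = (t - s) * n.+1%:R^-1.
    by rewrite /x -(natr1 i); ring.
  have sum (f : R -> R) :
      f t - f s = \sum_(0 <= i < n.+1) (f (x i.+1) - f (x i)).
    by rewrite (telescope_sumr (f \o x))//= xn x0.
  rewrite (sum h) (sum k) mulr_sumr mulr_suml; apply: ler_sum => i _.
  rewrite -(mulrA K) -(dx i) mulrAC; apply: hk.
    by rewrite addr_ge0// mulr_ge0// ?subr_ge0// divr_ge0.
  by rewrite -subr_ge0 dx mulr_ge0 ?subr_ge0.
have lim : c * (k t - k s) * expR (K * (t - s) * n.+1%:R^-1) @[n --> \oo] -->
    c * (k t - k s) * expR (K * (t - s) * 0).
  apply: cvgMr; apply: continuous_cvg; first exact: continuous_expR.
  by apply: cvgMr; exact: cvg_harmonic.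
rewrite mulr0 expR0 mulr1 in lim.
by apply: (cvgr_to_ge lim); exact: nearW.
Qed.

(** Piecewise linear interpolation; every slope [a n.+1 - a n] is positive. *)
Lemma increasing_interpolation (R : realType) (a : nat -> R) :
  (forall k, a k < a k.+1) ->
  exists2 g, strictly_increasing_pos g & forall k, g k%:R = a k.
Proof.
move=> a_lt.
have a_le m n : (m <= n)%N -> a m <= a n.
  by move=> mn; apply: (homo_leq (r := <=%R)) mn => [x|y x z|k];
    [exact: lexx|exact: le_trans|exact/ltW].
pose g (v : R) :=
  let n := Num.trunc v in a n + (v - n%:R) * (a n.+1 - a n).
exists g => [u v u0 uv|k]; last by rewrite /g natrK subrr mul0r addr0.
have v0 : 0 < v by exact: lt_trans uv.
have /andP[nu un] := truncn_itv (ltW u0).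
have /andP[nv vn] := truncn_itv (ltW v0).
rewrite /g; move: nu un nv vn.
set m := Num.trunc u; set n := Num.truncn v => mu um nv vn.
have mn : (m <= n)%N by rewrite -ltnS -(ltr_nat R); lra.
have am := a_lt m; have an := a_lt n.
case: (ltngtP m n) mn => // [mn _|mn _].
  have /le_lt_trans : a m.+1 <= a n by exact: a_le.
  have : a m + (u - m%:R) * (a m.+1 - a m) < a m.+1.
    rewrite -natr1 in um.
    by have : (u - m%:R) * (a m.+1 - a m) < 1 * (a m.+1 - a m);
      [rewrite ltr_pM2r ?subr_gt0//; lra|lra].
  have : 0 <= (v - n%:R) * (a n.+1 - a n) by rewrite mulr_ge0; lra.
  by move=> ? ? _; have := a_le _ _ mn; lra.
by rewrite -mn ltrD2l ltr_pM2r ?subr_gt0// ltrD2r.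
Qed.

(** * Tails and quantiles *)

Section MeasurableEvents.
Context d (T : measurableType d) (R : realType).
Implicit Types f g : T -> \bar R.

Lemma measurable_ltT f g : measurable_fun setT f -> measurable_fun setT g ->
  measurable [set w | (f w < g w)%E].
Proof.
by move=> mf mg; rewrite -[X in measurable X]setTI; exact: measurable_lte.
Qed.

Lemma measurable_leT f g : measurable_fun setT f -> measurable_fun setT g ->
  measurable [set w | (f w <= g w)%E].
Proof.
by move=> mf mg; rewrite -[X in measurable X]setTI; exact: measurable_lee.
Qed.

Lemma measurable_eqT f g : measurable_fun setT f -> measurable_fun setT g ->
  measurable [set w | f w = g w].
Proof.
by move=> mf mg; rewrite -[X in measurable X]setTI; exact: measurable_eqe.
Qed.

Lemma measurable_preimageT f (B : set (\bar R)) :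
  measurable_fun setT f -> measurable B -> measurable (f @^-1` B).
Proof. by move=> mf mB; rewrite -[X in measurable X]setTI; exact: mf. Qed.

Lemma measurable_rv_min f g : measurable_fun setT f -> measurable_fun setT g ->
  measurable_fun setT (rv_min f g).
Proof. exact: measurable_mine. Qed.

End MeasurableEvents.

Ltac event_measurable :=
  repeat first
    [ assumption | exact: measurableT | exact: measurable_cst
    | exact: measurable_id | apply: measurableI | apply: measurableC
    | apply: measurable_ltT | apply: measurable_leT | apply: measurable_eqT
    | apply: measurable_preimageT | apply: measurable_rv_min ].

(** * Probabilities as real numbers *)

Section RealProbability.
Context d (T : measurableType d) (R : realType) (P : probability T R).
Implicit Types A B : set T.

(** Real values let [lra], [nra] and [ring] work on probabilities. *)
Definition pr A : R := fine (P A).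

Lemma prE A : measurable A -> P A = (pr A)%:E.
Proof. by move=> mA; rewrite fineK// fin_num_measure. Qed.

Lemma pr_ge0 A : 0 <= pr A.
Proof. exact: fine_ge0. Qed.

Lemma pr_setT : pr setT = 1.
Proof. by rewrite /pr probability_setT. Qed.

Lemma le_pr A B : measurable A -> measurable B -> A `<=` B -> pr A <= pr B.
Proof.
by move=> mA mB AB; rewrite -lee_fin -!prE//; apply: le_measure; rewrite ?inE.
Qed.

Lemma pr_le1 A : measurable A -> pr A <= 1.
Proof. by move=> mA; rewrite -pr_setT le_pr. Qed.

Lemma prU A B : measurable A -> measurable B -> A `&` B = set0 ->
  pr (A `|` B) = pr A + pr B.
Proof.
move=> mA mB AB; apply: EFin_inj.
by rewrite EFinD -!prE// ?measureU//; exact: measurableU.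
Qed.

Lemma pr_splitI A B : measurable A -> measurable B ->
  pr A = pr (A `&` B) + pr (A `&` ~` B).
Proof.
move=> mA mB; rewrite -prU; [by rewrite -setIUr setUv setIT| | |];
  try by event_measurable.
by rewrite setIACA setICr setI0.
Qed.

Lemma pr_setC A : measurable A -> pr (~` A) = 1 - pr A.
Proof.
by move=> mA; rewrite -pr_setT (pr_splitI measurableT mA) !setTI addrC addKr.
Qed.

Lemma pr_bigcup_le (F : (set T)^nat) u : (forall n, measurable (F n)) ->
  nondecreasing_seq F -> (forall n, pr (F n) <= u) -> pr (\bigcup_n F n) <= u.
Proof.
move=> mF ndF Fu; have mU := bigcupT_measurable _ mF.
rewrite -lee_fin -prE//.
apply: (cvge_to_le (nondecreasing_cvg_mu mF mU ndF)); apply: nearW => n /=.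
by rewrite prE// lee_fin.
Qed.

Lemma pr_bigcap_ge (F : (set T)^nat) u : (forall n, measurable (F n)) ->
  nonincreasing_seq F -> (forall n, u <= pr (F n)) -> u <= pr (\bigcap_n F n).
Proof.
move=> mF niF Fu.
have mI : measurable (\bigcap_n F n) by exact: bigcapT_measurable.
rewrite -lee_fin -prE//.
have F0 : (P (F 0%N) < +oo)%E by rewrite prE// ltry.
apply: (cvge_to_ge (nonincreasing_cvg_mu F0 mF mI niF)).
by apply: nearW => n /=; rewrite prE// lee_fin.
Qed.

Lemma pr_ae_eq A B (N : set T) : measurable A -> measurable B -> measurable N ->
  pr N = 0 -> A `&` ~` N = B `&` ~` N -> pr A = pr B.
Proof.
move=> mA mB mN N0 AB.
rewrite (pr_splitI mA mN) (pr_splitI mB mN) AB; congr (_ + _).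
have null C : measurable C -> pr (C `&` N) = 0.
  move=> mC; apply/eqP; rewrite eq_le pr_ge0 andbT -N0 le_pr//.
  by event_measurable.
by rewrite !null.
Qed.

End RealProbability.

Section Tails.
Context d (T : measurableType d) (R : realType) (P : probability T R).
Variable Z : T -> \bar R.
Hypothesis mZ : measurable_fun setT Z.

(* Tails are taken at extended reals so that [-oo], where the tail is 1, can
   serve as the left end of an interval. *)
Definition tail (t : \bar R) : R := pr P [set w | (t < Z w)%E].

Lemma le_tail s t : (s <= t)%E -> tail t <= tail s.
Proof.
move=> st; apply: le_pr => [| |w /=]; try by event_measurable.
exact: le_lt_trans.
Qed.

Lemma tail_ge0 t : 0 <= tail t.
Proof. exact: pr_ge0. Qed.

Lemma tail_le1 t : tail t <= 1.
Proof. by apply: pr_le1; event_measurable. Qed.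

Lemma pr_le_tail t : pr P [set w | (Z w <= t)%E] = 1 - tail t.
Proof.
rewrite -pr_setC; last by event_measurable.
by congr (pr P _); apply/seteqP; split=> w /=; rewrite leNgt => /negP.
Qed.

Lemma pr_itv_oc s t : (s <= t)%E ->
  pr P [set w | (s < Z w)%E /\ (Z w <= t)%E] = tail s - tail t.
Proof.
move=> st; have mC : measurable [set w | (t < Z w)%E] by event_measurable.
have ms : measurable [set w | (s < Z w)%E] by event_measurable.
rewrite /tail (pr_splitI P ms mC).
rewrite [X in pr P X + _](_ : _ = [set w | (t < Z w)%E]); last first.
  by apply/seteqP; split=> w /= => [[]//|tZ]; split=> //; exact: le_lt_trans tZ.
rewrite addrAC subrr add0r; congr (pr P _).
by apply/seteqP; split=> w [? /=]; rewrite leNgt => ?; split=> //; apply/negP.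
Qed.

Lemma pr_itv_oo s t : (s < t)%E ->
  pr P [set w | (s < Z w)%E /\ (Z w < t)%E] =
  tail s - pr P [set w | (t <= Z w)%E].
Proof.
move=> st; have mC : measurable [set w | (t <= Z w)%E] by event_measurable.
have ms : measurable [set w | (s < Z w)%E] by event_measurable.
rewrite /tail (pr_splitI P ms mC).
rewrite [X in pr P X + _](_ : _ = [set w | (t <= Z w)%E]); last first.
  by apply/seteqP; split=> w /= => [[]//|tZ]; split=> //; exact: lt_le_trans tZ.
rewrite addrAC subrr add0r; congr (pr P _).
apply/seteqP; split=> w [sZ /= Zt]; split=> //.
  by rewrite /= leNgt Zt.
by rewrite ltNge; exact/negP.
Qed.

Lemma pr_ge_tail t :
  pr P [set w | (t <= Z w)%E] = pr P [set w | Z w = t] + tail t.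
Proof.
rewrite -prU; [|event_measurable|event_measurable|].
  congr (pr P _); apply/seteqP; split=> w /=.
    by rewrite le_eqVlt => /predU1P[->|]; [left|right].
  by case=> [->//|/ltW].
by apply/seteqP; split=> w //= [->]; rewrite ltxx.
Qed.

(** Right continuity of the tail: [{Z > t}] is the increasing union of the events
    [{Z > t + 1 / (n + 1)}]. *)
Lemma tail_right_ge (t u : R) :
  (forall s : R, t < s -> tail s%:E <= u) -> tail t%:E <= u.
Proof.
move=> su; rewrite /tail.
rewrite (_ : [set w | (t%:E < Z w)%E] =
  \bigcup_n [set w | ((t + n.+1%:R^-1)%:E < Z w)%E]).
  apply: pr_bigcup_le => [n|m n mn|n]; first by event_measurable.
    apply/subsetPset => w /=; apply: le_lt_trans.
    by rewrite lee_fin lerD2l lef_pV2 ?posrE ?ltr0n// ler_nat.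
  by apply: su; rewrite ltrDl invr_gt0 ltr0n.
apply/seteqP; split=> w /= => [tZ|[n _ /=]]; last first.
  by apply: lt_trans; rewrite lte_fin ltrDl invr_gt0 ltr0n.
case Zw : (Z w) => [z||]; rewrite Zw ?ltxx// in tZ; last first.
  by exists 0%N => //=; rewrite Zw ltry.
rename tZ into tz; rewrite lte_fin in tz.
exists (Num.bound (z - t)^-1) => //=; rewrite Zw.
have zt0 : 0 < z - t by rewrite subr_gt0.
rewrite lte_fin addrC -ltrBrDr invf_plt ?posrE ?ltr0n//.
rewrite (lt_trans (archi_boundP _)) ?invr_ge0 ?ltW//.
by rewrite ltr_nat.
Qed.

(** The left limit of the tail includes the atom at [t]: the events [{Z > t - 1 / (n + 1)}] decrease
    to [{Z >= t}]. *)
Lemma tail_left_le (t u : R) :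
  (forall s : R, s < t -> u <= tail s%:E) ->
  u <= pr P [set w | (t%:E <= Z w)%E].
Proof.
move=> su.
rewrite (_ : [set w | (t%:E <= Z w)%E] =
  \bigcap_n [set w | ((t - n.+1%:R^-1)%:E < Z w)%E]).
  apply: pr_bigcap_ge => [n|m n mn|n]; first by event_measurable.
    apply/subsetPset => w /=; apply: le_lt_trans.
    by rewrite lee_fin lerD2l lerN2 lef_pV2 ?posrE ?ltr0n// ler_nat.
  by apply: su; rewrite ltrBlDr ltrDl invr_gt0 ltr0n.
apply/seteqP; split=> w /= => [tZ n _ /=|tZ].
  by apply: lt_le_trans tZ; rewrite lte_fin ltrBlDr ltrDl invr_gt0 ltr0n.
rewrite leNgt; apply/negP => Zt.
case Zw : (Z w) => [z||]; rewrite Zw in Zt;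
  [|by rewrite ltNge leey in Zt|]; last first.
  by have := tZ 0%N Logic.I; rewrite /= Zw ltNge leNye.
rename Zt into zt; rewrite lte_fin in zt.
have := tZ (Num.bound (t - z)^-1) Logic.I; rewrite /= Zw.
have tz0 : 0 < t - z by rewrite subr_gt0.
rewrite lte_fin ltrBlDr -ltrBlDl; apply/negP; rewrite -leNgt ltW//.
rewrite invf_plt ?posrE ?ltr0n//.
rewrite (lt_trans (archi_boundP _)) ?invr_ge0 ?ltW//.
by rewrite ltr_nat.
Qed.

(** Continuity of the tail at [-oo]; with [taily_ge] it makes the set that defines a quantile
    bounded below and nonempty. *)
Lemma tailNy_le (u : R) : (forall s : R, tail s%:E <= u) -> tail -oo%E <= u.
Proof.
move=> su; rewrite /tail.
rewrite (_ : [set w | (-oo < Z w)%E] =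
  \bigcup_n [set w | ((- n%:R : R)%:E < Z w)%E]).
  apply: pr_bigcup_le => [n|m n mn|n]; [by event_measurable| |exact: su].
  apply/subsetPset => w /=; apply: le_lt_trans.
  by rewrite lee_fin lerN2 ler_nat.
apply/seteqP; split=> w /= => [tZ|[n _ /=]]; last first.
  by apply: lt_trans; rewrite ltNye.
case Zw : (Z w) => [z||]; rewrite Zw ?ltxx// in tZ; last first.
  by exists 0%N => //=; rewrite Zw ltry.
exists (Num.bound (- z)) => //=; rewrite Zw lte_fin ltrNl.
case: (lerP 0 (- z)) => [/archi_boundP//|z0].
by rewrite (lt_le_trans z0)// ler0n.
Qed.

Lemma taily_ge (u : R) : (forall s : R, u <= tail s%:E) ->
  u <= pr P [set w | Z w = +oo%E].
Proof.
move=> su.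
rewrite (_ : [set w | Z w = +oo%E] =
  \bigcap_n [set w | ((n%:R : R)%:E < Z w)%E]).
  apply: pr_bigcap_ge => [n|m n mn|n]; [by event_measurable| |exact: su].
  apply/subsetPset => w /=; apply: le_lt_trans.
  by rewrite lee_fin ler_nat.
apply/seteqP; split=> w /= => [Zw n _ /=|tZ]; first by rewrite Zw ltry.
case Zw : (Z w) => [z|//|]; last by have := tZ 0%N Logic.I; rewrite /= Zw.
have := tZ (Num.bound z) Logic.I; rewrite /= Zw lte_fin => bz.
have := archi_boundP (le_trans (ler0n _ _) (ltW bz)).
by rewrite ltNge (ltW bz).
Qed.

Hypothesis fZ : as_finite P Z.

Lemma pr_infinite A : measurable A ->
  A `<=` [set w | Z w = -oo%E] `|` [set w | Z w = +oo%E] -> pr P A = 0.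
Proof.
case: fZ => N [mN N0 sN] mA AZ; apply/eqP; rewrite eq_le pr_ge0 andbT.
have -> : 0 = pr P N by rewrite /pr N0.
by apply: le_pr => // w /AZ Zw; apply: sN => /=; case: Zw => /= ->.
Qed.

Lemma pr_eqy : pr P [set w | Z w = +oo%E] = 0.
Proof. by apply: pr_infinite => [|w ?]; [event_measurable|right]. Qed.

Lemma tailNy : tail -oo%E = 1.
Proof.
have /eqP : pr P [set w | (Z w <= -oo)%E] = 0.
  apply: pr_infinite => [|w /=]; first by event_measurable.
  by rewrite leeNy_eq => /eqP; left.
by rewrite pr_le_tail subr_eq0 => /eqP.
Qed.

(** The generalized inverse of the nonincreasing tail. *)
Definition upper_quantile (u : R) : R := inf [set t : R | tail t%:E <= u].

(** A Galois connection: right continuity of the tail makes the infimum a member of the set. *)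
Lemma upper_quantile_le (u t : R) : 0 < u < 1 ->
  (upper_quantile u <= t) = (tail t%:E <= u).
Proof.
move=> /andP[u0 u1]; set S := [set t : R | tail t%:E <= u].
(* Otherwise the tail is at most [u < 1] everywhere, hence also at [-oo], where it is 1. *)
have S_lb : has_lbound S.
  apply: contrapT => nlb.
  suff : 1 <= u by rewrite leNgt u1.
  rewrite -tailNy; apply: tailNy_le => s.
  rewrite leNgt; apply/negP => us; apply: nlb; exists s => x Sx.
  rewrite leNgt; apply/negP => xs.
  have := @le_tail x%:E s%:E; rewrite lee_fin => /(_ (ltW xs)).
  by move: Sx; rewrite /S/=; lra.
(* If the set were empty, [Z = +oo] would have probability at least [u > 0]. *)
have S0 : S !=set0.
  apply/set0P/eqP => S0.
  suff : u <= 0 by rewrite leNgt u0.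
  rewrite -pr_eqy; apply: taily_ge => s.
  rewrite leNgt; apply/negP => su.
  have Ss : S s by apply: ltW su.
  by rewrite S0 in Ss.
apply/idP/idP => [Qt|St]; last exact: ge_inf.
apply: tail_right_ge => s ts.
have [x Sx xs] : exists2 x, S x & x < s.
  by apply: inf_lt => //; exact: le_lt_trans ts.
by apply: le_trans Sx; apply: le_tail; rewrite lee_fin ltW.
Qed.

End Tails.

(** * Uniqueness of laws on the extended line *)

Section LawUniqueness.
Context (R : realType).

(** A pi-system for the uniqueness theorem. [setT] is included because the class must exhaust the
    line, and no ray contains [-oo]. *)
Let rays_or_setT : set (set (\bar R)) :=
  [set B | B = setT \/ exists r : R, B = [set x | (r%:E < x)%E]].

Let measurable_ray (r : R) : measurable [set x : \bar R | (r%:E < x)%E].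
Proof. by event_measurable. Qed.

Let measurable_gen : measurable = <<s rays_or_setT >>.
Proof.
apply/seteqP; split; last first.
  apply: smallest_sub; first exact: sigma_algebra_measurable.
  by move=> B [->|[r ->]].
have -> : (@measurable _ (\bar R)) = <<s @ErealGenOInfty.G R >>.
  exact: ErealGenOInfty.measurableE.
apply: smallest_sub; first exact: smallest_sigma_algebra.
move=> _ [r ->]; apply: sub_sigma_algebra; right; exists r.
by apply/seteqP; split=> x /=; rewrite in_itv/= andbT.
Qed.

Let setI_rays : setI_closed rays_or_setT.
Proof.
move=> _ _ [->|[r ->]] [->|[s ->]]; rewrite ?setTI ?setIT;
  [by left|by right; exists s|by right; exists r|right].
exists (Num.max r s); rewrite /setI; apply/seteqP; split=> x /=;
  by rewrite EFin_max gt_max => /andP.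
Qed.

Lemma measure_ereal_unique (m1 m2 : {measure set (\bar R) -> \bar R}) :
  (m1 setT < +oo)%E -> m1 setT = m2 setT ->
  (forall t : R, m1 [set x | (x <= t%:E)%E] = m2 [set x | (x <= t%:E)%E]) ->
  forall B, measurable B -> m1 B = m2 B.
Proof.
move=> m1oo m12T m12 B mB.
apply: (measure_unique rays_or_setT (fun=> setT)) => //.
- by left.
- by apply/seteqP; split=> // x _; exists 0%N.
- move=> _ [->//|[r ->]].
  have -> : [set x | (r%:E < x)%E] = setT `\` [set x | (x <= r%:E)%E].
    apply/seteqP; split=> x /= => [rx|[_ xr]];
      last by rewrite ltNge; exact/negP.
    by split=> //; apply/negP; rewrite -ltNge.
  have mle : measurable [set x : \bar R | (x <= r%:E)%E] by event_measurable.
  rewrite !measureD// ?setTI; last by move: m1oo; rewrite m12T.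
  by congr (_ - _)%E; [exact: m12T|exact: m12].
Qed.

(** Half-lines determine the image law. The two maps may live on different spaces, so that the law
    of [Z] can be compared with that of [g V]. *)
Lemma pushforward_unique d1 d2 (T1 : measurableType d1) (T2 : measurableType d2)
    (m1 : {measure set T1 -> \bar R}) (m2 : {measure set T2 -> \bar R})
    (f1 : T1 -> \bar R) (f2 : T2 -> \bar R) :
  measurable_fun setT f1 -> measurable_fun setT f2 ->
  (m1 setT < +oo)%E -> m1 setT = m2 setT ->
  (forall t : R,
     m1 [set w | (f1 w <= t%:E)%E] = m2 [set w | (f2 w <= t%:E)%E]) ->
  forall B, measurable B -> m1 (f1 @^-1` B) = m2 (f2 @^-1` B).
Proof.
move=> mf1 mf2 m1oo m12T m12.
have [n1 n1E] : exists n : {measure set (\bar R) -> \bar R},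
    forall B, n B = m1 (f1 @^-1` B).
  by unshelve eexists (pushforward m1 f1 : {measure set (\bar R) -> \bar R}).
have [n2 n2E] : exists n : {measure set (\bar R) -> \bar R},
    forall B, n B = m2 (f2 @^-1` B).
  by unshelve eexists (pushforward m2 f2 : {measure set (\bar R) -> \bar R}).
move=> B mB; rewrite -n1E -n2E; apply: measure_ereal_unique => //.
- by rewrite n1E.
- by rewrite n1E n2E.
- by move=> t; rewrite n1E n2E; exact: m12.
Qed.

End LawUniqueness.

(** The definition only tests half-lines. There the image under [Z] of [P] restricted to [A] agrees
    with that of [P] scaled by [P A], so the two images are equal. *)
Lemma indep_of_event_preimage d (T : measurableType d) (R : realType)
    (P : probability T R) (Z : T -> \bar R) (A : set T) :
  measurable_fun setT Z -> measurable A -> indep_of_event P Z A ->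
  forall B, measurable B -> pr P (Z @^-1` B `&` A) = pr P (Z @^-1` B) * pr P A.
Proof.
move=> mZ mA ZA B mB; apply: EFin_inj.
have mZB := measurable_preimageT mZ mB.
rewrite EFinM -!prE//; last exact: measurableI.
pose m1 := [the {measure set T -> \bar R} of mrestr P mA].
pose m2 := [the {measure set T -> \bar R} of mscale (NngNum (pr_ge0 P A)) P].
transitivity (m1 (Z @^-1` B)); first by [].
transitivity (m2 (Z @^-1` B)); last by rewrite /m2/= /mscale/= muleC -prE.
apply: pushforward_unique => //.
- by rewrite /m1/= /mrestr setTI prE// ltry.
- by rewrite /m1 /m2/= /mrestr /mscale setTI/= probability_setT mule1 -prE.
- by move=> t; rewrite /m1 /m2/= /mrestr /mscale/= ZA muleC -prE.
Qed.

(** * The exponential case *)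

(** If [e > 0], then [v = 1 / (K e)] gives [expR (1 / e) <= 1 / e], against [1 + x <= expR x]. *)
Lemma expR_lower_bound_le0 (R : realType) (K e : R) : 0 < K ->
  (forall v, 0 < v -> e <= expR (- (K * v))) -> e <= 0.
Proof.
move=> K0 ev; rewrite leNgt; apply/negP => e0.
have v0 : 0 < (K * e)^-1 by rewrite invr_gt0 mulr_gt0.
have := ev _ v0; rewrite expRN -lef_pV2 ?posrE ?invr_gt0 ?expR_gt0// invrK.
have := expR_ge1Dx (K * (K * e)^-1).
have -> : K * (K * e)^-1 = e^-1 by rewrite invfM mulrA divff ?gt_eqF// mul1r.
lra.
Qed.

Section ExponentialLaw.
Context (R : realType).

Local Notation RM := (measurableTypeR R).

Lemma exponential_prob_set1 (lambda u : R) :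
  exponential_prob lambda [set u] = 0%E.
Proof. by rewrite /exponential_prob integral_set1. Qed.

(** Packages [exponential_prob] as a probability, to make the additivity lemmas available. *)
Lemma exponential_probability (lambda : R) : 0 < lambda ->
  exists m : probability RM R, forall B, m B = exponential_prob lambda B.
Proof.
by move=> l0; unshelve eexists (exponential_prob lambda : probability RM R).
Qed.

(** The total mass is split at [0] and [v]: the density vanishes on the negative half-line, and the
    mass of [[0, v]] is known. *)
Lemma exponential_prob_tail (lambda v : R) : 0 < lambda -> 0 <= v ->
  exponential_prob lambda [set x | v < x] = (expR (- (lambda * v)))%:E.
Proof.
move=> l0 v0; have [m mE] := exponential_probability l0.
have mT : m setT = 1%E by exact: probability_setT.
have m_neg : m [set x | x < 0] = 0%E.
  rewrite mE; apply: integral0_eq => x /= x0.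
  by rewrite /exponential_pdf patchE memNset//= in_itv/= andbT leNgt x0.
have m_0v : m `[0, v]%classic = (1 - expR (- (lambda * v)))%:E.
  rewrite mE; move: v0; rewrite le_eqVlt => /predU1P[<-|v0].
    by rewrite set_itv1 exponential_prob_set1 mulr0 oppr0 expR0 subrr.
  by rewrite exponential_prob_itv0c// mulNr.
have mv : measurable ([set x | v < x] : set RM).
  by rewrite -(_ : `]v, +oo[%classic = [set x | v < x])// set_itvE.
have mv' : measurable (`[0, v]%classic : set RM) by [].
have m0 : measurable ([set x | x < 0] : set RM).
  by rewrite -(_ : `]-oo, 0[%classic = [set x | x < 0])// set_itvE.
pose N : set RM := [set x | x < 0].
pose I : set RM := `[0, v]%classic.
pose J : set RM := [set x | v < x].
have -> : [set x | v < x] = J by [].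
have mNI : m (N `|` I) = (m N + m I)%E.
  apply: measureU => //.
  apply/seteqP; split=> x //; rewrite /N /I /= in_itv/=.
  by move=> -[x0 /andP[x0' _]]; lra.
have : m setT = (m (N `|` I) + m J)%E.
  rewrite -[RHS]measureU//; last 2 first.
    by apply: measurableU.
    apply/seteqP; split=> x //; rewrite /N /I /J /= in_itv/=.
    by move=> -[[x0|/andP[_ xv]] vx]; lra.
  congr (m _); apply/seteqP; split=> x //= _.
  case: (ltP x 0) => [|x0]; first by left; left.
  by case: (leP x v) => [xv|]; [left; right; rewrite /I/= in_itv/= x0|right].
rewrite mT mNI m_neg add0e m_0v -mE.
case: (m _) => [z /eqP||]//; rewrite -EFinD eqe => /eqP zE.
by congr _%:E; lra.
Qed.

(** As [g] increases, the set is empty or a ray from its infimum [u], up to a null endpoint. The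
    same [u] serves every rate, which lets several variables be compared at one [t]. *)
Lemma image_law_tail (g : R -> R) (t : R) : strictly_increasing_pos g ->
  (forall lambda, 0 < lambda ->
     exponential_prob lambda [set v | 0 < v /\ t < g v] = 0%E) \/
  (exists2 u, 0 <= u & forall lambda, 0 < lambda ->
     exponential_prob lambda [set v | 0 < v /\ t < g v] =
     (expR (- (lambda * u)))%:E).
Proof.
move=> gi; set S := [set v | 0 < v /\ t < g v].
have [S0|/set0P S0] := eqVneq S set0.
  left=> l l0; have [m mE] := exponential_probability l0.
  by rewrite -mE S0 measure0.
have S_lb : lbound S 0 by move=> x [/ltW].
have lbS : has_lbound S by exists 0.
have u0 : 0 <= inf S by exact: lb_le_inf.
right; exists (inf S) => // l l0; rewrite -exponential_prob_tail//.
have [m mE] := exponential_probability l0.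
have gt_inf x : inf S < x -> S x.
  move=> /(inf_lt S0)[y [y0 ty] yx]; split; first exact: lt_trans yx.
  exact: lt_trans (gi _ _ y0 yx).
have [Su|nSu] := pselect (S (inf S)).
  pose U : set RM := [set inf S]; pose V : set RM := [set x | inf S < x].
  have SE : S = U `|` V.
    apply/seteqP; split=> [x Sx|x [->//|/gt_inf//]].
    have : inf S <= x by exact: ge_inf.
    by rewrite le_eqVlt => /predU1P[/esym|]; [left|right].
  have mV : measurable V.
    by rewrite -(_ : `]inf S, +oo[%classic = V)// set_itvE.
  have mUV : m (U `|` V) = (m U + m V)%E.
    apply: measureU => //; first exact: measurable_set1.
    by apply/seteqP; split=> x //= [->]; rewrite /V/= ltxx.
  transitivity (exponential_prob l (U `|` V)); first by rewrite -SE.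
  by rewrite -mE mUV !mE /U exponential_prob_set1 add0e.
congr (exponential_prob l _); apply/seteqP; split=> [x Sx /=|x /gt_inf//].
rewrite lt_neqAle ge_inf// andbT; apply/eqP => xE; apply: nSu.
by rewrite xE.
Qed.

End ExponentialLaw.

Section ExponentialTails.
Context d (T : measurableType d) (R : realType) (P : probability T R).
Variables (g : R -> R) (Z : T -> \bar R).
Hypotheses (g_incr : strictly_increasing_pos g) (mZ : measurable_fun setT Z).
Local Notation RM := (measurableTypeR R).

Lemma g_exponential_of_tail (lambda : R) : 0 < lambda ->
  (forall t : R, (tail P Z t%:E)%:E =
     exponential_prob lambda [set v | 0 < v /\ t < g v]) ->
  g_exponential P g Z.
Proof.
move=> l0 tailE; exists lambda => // B mB; rewrite /image_law.
have [m mE] := exponential_probability l0; rewrite -mE.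
(* [h] extends [g] by [-oo], so that preimages of rays are intervals and [h] is measurable; the
   half-line where its value is artificial has mass 0. *)
pose h (v : RM) : \bar R := if 0 < v then (g v)%:E else -oo%E.
have hE (t : R) : [set v | (t%:E < h v)%E] = [set v | 0 < v /\ t < g v].
  apply/seteqP; split=> v; rewrite /h /=.
    by case: ifP => // v0; rewrite lte_fin.
  by case=> -> ?; rewrite lte_fin.
have mh : measurable_fun setT h.
  apply: (measurability _ (ErealGenOInfty.measurableE R)) => _ [_ [t ->] <-].
  rewrite setTI; apply: is_interval_measurable.
  rewrite (_ : _ @^-1` _ = [set v | 0 < v /\ t < g v]); last first.
    by rewrite -hE; apply/seteqP; split=> v /=; rewrite in_itv/= andbT.
  move=> x y [x0 tx] [y0 ty] z /andP[xz zy]; split; first exact: lt_le_trans xz.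
  move: xz; rewrite le_eqVlt => /predU1P[<-//|xz].
  exact: lt_trans (g_incr x0 xz).
have mpos : measurable ([set v | 0 < v] : set RM).
  by rewrite -(_ : `]0, +oo[%classic = [set v | 0 < v])// set_itvE.
have m_le0 : pr m (~` [set v | 0 < v]) = 0.
  rewrite pr_setC// /pr mE exponential_prob_tail//.
  by rewrite mulr0 oppr0 expR0 subrr.
have mhB := measurable_preimageT mh mB.
have hB : [set v | 0 < v /\ B (g v)%:E] = h @^-1` B `&` [set v | 0 < v].
  by apply/seteqP; split=> v /=; rewrite /h; [case=> -> ?|case: ifP => // _ []].
transitivity (m (h @^-1` B)).
  apply: pushforward_unique => //.
  - exact: le_lt_trans (probability_le1 P measurableT) (ltry 1).
  - exact: etrans (probability_setT P) (esym (probability_setT m)).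
  - move=> t; transitivity (1 - tail P Z t%:E)%:E.
      by rewrite -pr_le_tail// -prE//; event_measurable.
    rewrite (_ : tail P Z t%:E = tail m h t%:E).
      by rewrite -pr_le_tail// -prE//; event_measurable.
    by apply: EFin_inj; rewrite tailE /tail hE -prE ?mE// -hE; event_measurable.
(* [B] may contain [-oo], so the two sets agree only off that null half-line. *)
rewrite hB !prE//; last exact: measurableI.
congr _%:E; pose N : set RM := ~` [set v | 0 < v].
apply: (@pr_ae_eq _ _ _ m _ _ N) => //.
- exact: measurableI.
- exact: measurableC.
- by rewrite setCK -setIA setIid.
Qed.

Lemma tail_g_exponential (lambda : R) (t : \bar R) :
  (forall B : set (\bar R), measurable B ->
     P (Z @^-1` B) = image_law g (exponential_prob lambda) B) ->
  (tail P Z t)%:E = exponential_prob lambda [set v | 0 < v /\ (t < (g v)%:E)%E].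
Proof.
move=> ZE; rewrite /tail -prE; last by event_measurable.
by apply: (ZE [set x | (t < x)%E]); event_measurable.
Qed.

End ExponentialTails.

(** * The minimum of two variables *)

Section Minimum.
Context d (T : measurableType d) (R : realType) (P : probability T R).
Variables X Y : T -> \bar R.
Hypotheses (mX : measurable_fun setT X) (mY : measurable_fun setT Y).

Lemma rv_minC : rv_min X Y = rv_min Y X.
Proof. by apply/funext => w; rewrite /rv_min minC. Qed.

Lemma pr_trichotomy C : measurable C ->
  pr P C = pr P (C `&` [set w | (X w < Y w)%E]) +
           pr P (C `&` [set w | (Y w < X w)%E]) +
           pr P (C `&` [set w | X w = Y w]).
Proof.
move=> mC.
pose A := C `&` [set w | (X w < Y w)%E].
pose B := C `&` [set w | (Y w < X w)%E].
pose D := C `&` [set w | X w = Y w].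
have mA : measurable A by rewrite /A; event_measurable.
have mB : measurable B by rewrite /B; event_measurable.
have mD : measurable D by rewrite /D; event_measurable.
rewrite -/A -/B -/D -[in RHS](prU P mA mB); last first.
  by apply/seteqP; split=> w //= [[_ /= XY] [_ /=]]; rewrite ltNge (ltW XY).
rewrite -prU//; [|exact: measurableU|]; last first.
  apply/seteqP; split=> w //= [[[_ /= +]|[_ /= +]] [_ /= XY]];
    by rewrite XY ltxx.
congr (pr P _); apply/seteqP; split=> w; last by move=> [[[]|[]]|[]].
by move=> Cw; case: (ltgtP (X w) (Y w)) => XY; [left; left|left; right|right].
Qed.

Hypothesis indep : independent_rv P X Y.

Lemma pr_indep A B : measurable A -> measurable B ->
  pr P (X @^-1` A `&` Y @^-1` B) = pr P (X @^-1` A) * pr P (Y @^-1` B).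
Proof.
move=> mA mB; apply: EFin_inj; rewrite EFinM -!prE ?indep//;
  by event_measurable.
Qed.

Lemma tail_rv_min t : tail P (rv_min X Y) t = tail P X t * tail P Y t.
Proof.
rewrite /tail -(pr_indep (A := [set x | (t < x)%E]) (B := [set x | (t < x)%E]));
  [|by event_measurable..].
by congr (pr P _); apply/seteqP; split=> w /=; rewrite lt_min => /andP.
Qed.

End Minimum.

Section EventsOfMinimum.
Context d (T : measurableType d) (R : realType) (P : probability T R).

Lemma pr_le_setI_diff (Z : T -> \bar R) (A : set T) (s t : \bar R) :
  measurable_fun setT Z -> measurable A -> (s <= t)%E ->
  pr P ([set w | (Z w <= t)%E] `&` A) - pr P ([set w | (Z w <= s)%E] `&` A) =
  pr P ([set w | (s < Z w)%E /\ (Z w <= t)%E] `&` A).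
Proof.
move=> mZ mA st; apply/eqP; rewrite subr_eq; apply/eqP; rewrite addrC -prU.
- congr (pr P _); apply/seteqP; split=> w /=.
    by case=> Zt Aw; case: (leP (Z w) s) => Zs; [left|right].
  by case=> [[Zs]|[[]]//]; split=> //; exact: le_trans st.
- by event_measurable.
- by apply: measurableI => //; apply: measurableI; event_measurable.
- by apply/seteqP; split=> w //= [[Zs _] [[]]]; rewrite ltNge Zs.
Qed.

Lemma event_eqC (X Y : T -> \bar R) :
  [set w | X w = Y w] = [set w | Y w = X w].
Proof. by apply/seteqP; split=> w /= ->. Qed.

Lemma independent_rvC (X Y : T -> \bar R) :
  independent_rv P X Y -> independent_rv P Y X.
Proof. by move=> XY A B mA mB; rewrite setIC XY// muleC. Qed.

Variables X Y : T -> \bar R.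
Hypotheses (mX : measurable_fun setT X) (mY : measurable_fun setT Y).
Hypothesis indep : independent_rv P X Y.
Local Notation Z := (rv_min X Y).

(** On this event [Z = X], so [X] lies in the interval and [Y > X > s]. *)
Lemma pr_first_cause_le (s t : \bar R) : (s <= t)%E ->
  pr P ([set w | (s < Z w)%E /\ (Z w <= t)%E] `&` [set w | (X w < Y w)%E]) <=
  tail P Y s * (tail P X s - tail P X t).
Proof.
move=> st; rewrite mulrC -pr_itv_oc// /tail.
have mI : measurable [set x : \bar R | (s < x)%E /\ (x <= t)%E].
  by apply: measurableI; event_measurable.
rewrite -(pr_indep mX mY indep (A := [set x | (s < x)%E /\ (x <= t)%E])
  (B := [set x | (s < x)%E]))//; last by event_measurable.
apply: le_pr.
- apply: measurableI; first apply: measurableI; by event_measurable.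
- by event_measurable.
- move=> w [[/= sZ Zt] XY]; move: sZ Zt; rewrite /rv_min min_l ?(ltW XY)//.
  by move=> sX Xt; split=> //=; exact: lt_trans XY.
Qed.

End EventsOfMinimum.

(** * Exponential laws imply independence of time and cause *)

Section ExponentialTimeCause.
Context d (T : measurableType d) (R : realType) (P : probability T R).
Variable g : R -> R.
Hypothesis g_incr : strictly_increasing_pos g.

(** The value [-oo] makes [v = 0] a left end at which the tails below equal 1. *)
Let gg (v : R) : \bar R := if 0 < v then (g v)%:E else -oo%E.

Let le_gg s t : 0 <= s -> s <= t -> (gg s <= gg t)%E.
Proof.
rewrite /gg => s0; rewrite le_eqVlt => /predU1P[->//|st].
rewrite (le_lt_trans s0 st); case: ifP => // s0'; rewrite ?leNye//.
by rewrite lee_fin ltW// g_incr.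
Qed.

Let tail_gg Z lambda v : measurable_fun setT Z -> 0 < lambda ->
  (forall B : set (\bar R), measurable B ->
     P (Z @^-1` B) = image_law g (exponential_prob lambda) B) ->
  0 <= v -> tail P Z (gg v) = expR (- (lambda * v)).
Proof.
move=> mZ l0 ZE v0; apply: EFin_inj.
rewrite (tail_g_exponential mZ _ ZE) -exponential_prob_tail//.
congr (exponential_prob lambda _); apply/seteqP; split=> x /=; rewrite /gg.
  case=> x0; case: ifPn => [v0'|]; last by rewrite -leNgt; lra.
  rewrite lte_fin => gvx; rewrite ltNge; apply/negP.
  rewrite le_eqVlt => /predU1P[xv|xv]; first by rewrite xv ltxx in gvx.
  by move: gvx; rewrite ltNge ltW// g_incr.
move=> vx; split; first exact: le_lt_trans vx.
by case: ifP => v0'; rewrite ?ltNyr// lte_fin g_incr.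
Qed.

Section OneCause.
Variables (X Y : T -> \bar R) (lambda mu : R).
Hypotheses (mX : measurable_fun setT X) (mY : measurable_fun setT Y).
Hypothesis indep : independent_rv P X Y.
Hypotheses (lambda_gt0 : 0 < lambda) (mu_gt0 : 0 < mu).
Hypothesis XE : forall B : set (\bar R), measurable B ->
  P (X @^-1` B) = image_law g (exponential_prob lambda) B.
Hypothesis YE : forall B : set (\bar R), measurable B ->
  P (Y @^-1` B) = image_law g (exponential_prob mu) B.
Local Notation Z := (rv_min X Y).

Lemma tail_min_gg v : 0 <= v -> tail P Z (gg v) = expR (- ((lambda + mu) * v)).
Proof.
move=> v0; rewrite tail_rv_min// !(tail_gg _ _ XE, tail_gg _ _ YE)// -expRD.
by congr expR; ring.
Qed.

(** Let [K = lambda + mu]. From [s] to [t] the left side grows by at most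
    [lambda / K * expR (K * (t - s))] times the growth of [P (Z <= gg v)]; [increment_bound] removes
    the exponential factor. *)
Lemma exponential_cause_le v : 0 <= v ->
  pr P ([set w | (Z w <= gg v)%E] `&` [set w | (X w < Y w)%E]) <=
  lambda / (lambda + mu) * pr P [set w | (Z w <= gg v)%E].
Proof.
move=> v0.
pose A := [set w | (X w < Y w)%E].
have mA : measurable A by rewrite /A; event_measurable.
have mZ : measurable_fun setT Z by event_measurable.
pose h v := pr P ([set w | (Z w <= gg v)%E] `&` A).
pose k v := pr P [set w | (Z w <= gg v)%E].
have kE t : 0 <= t -> k t = 1 - expR (- ((lambda + mu) * t)).
  by move=> t0; rewrite /k pr_le_tail// tail_min_gg.
have k0 : k 0 = 0 by rewrite kE// mulr0 oppr0 expR0 subrr.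
have h0 : h 0 = 0.
  apply/eqP; rewrite eq_le pr_ge0 andbT -[leRHS]k0.
  by apply: le_pr => [| |w []//]; event_measurable.
suff : h v - h 0 <= lambda / (lambda + mu) * (k v - k 0).
  by rewrite h0 k0 !subr0.
apply: (increment_bound (K := lambda + mu)) => // s t s0 st.
have t0 := le_trans s0 st.
rewrite /h pr_le_setI_diff//; last exact: le_gg.
apply: le_trans (pr_first_cause_le mX mY indep (le_gg s0 st)) _.
rewrite !(tail_gg _ _ XE, tail_gg _ _ YE)// !kE//.
set K := lambda + mu; set D := t - s.
have K0 : 0 < K by rewrite addr_gt0.
have et (c : R) : expR (- (c * t)) = expR (- (c * s)) * expR (- (c * D)).
  by rewrite -expRD; congr expR; rewrite /D; ring.
have D0 : 0 <= D by rewrite subr_ge0.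
rewrite !et.
have -> : expR (- (K * s)) = expR (- (lambda * s)) * expR (- (mu * s)).
  by rewrite -expRD; congr expR; rewrite /K; ring.
set a := expR (- (lambda * s)); set b := expR (- (mu * s)).
have -> : b * (a - a * expR (- (lambda * D))) =
    a * b * (1 - expR (- (lambda * D))) by ring.
have e1 : expR (K * D) * expR (- (K * D)) = 1 by rewrite -expRD subrr expR0.
have -> : lambda / K * expR (K * D) *
    (1 - a * b * expR (- (K * D)) - (1 - a * b)) =
    a * b * (lambda / K * (expR (K * D) - 1)).
  by rewrite -[in RHS]e1; ring.
rewrite ler_pM2l ?mulr_gt0 ?expR_gt0//.
(* What remains is [1 - expR (- (lambda * D)) <= lambda * D <= lambda / K * (expR (K * D) - 1)],
   where [1 + x <= expR x] is used twice. *)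
have := expR_ge1Dx (- (lambda * D)).
have : lambda / K * (K * D) <= lambda / K * (expR (K * D) - 1).
  rewrite ler_pM2l ?divr_gt0//; have := expR_ge1Dx (K * D); lra.
have -> : lambda / K * (K * D) = lambda * D by field; rewrite gt_eqF.
lra.
Qed.

End OneCause.

(** The bounds of [exponential_cause_le] for the two strict orders add up to [P (Z <= gg v)], so
    both are equalities. Letting [v] grow identifies [P (X < Y)], and a [t] with positive tail can
    be replaced by a [gg u] with the same tail of [Z]. *)
Lemma exponential_cause_indep (X Y : T -> \bar R) (t : R) :
  measurable_fun setT X -> measurable_fun setT Y -> independent_rv P X Y ->
  g_exponential P g X -> g_exponential P g Y ->
  pr P [set w | X w = Y w] = 0 ->
  pr P ([set w | (rv_min X Y w <= t%:E)%E] `&` [set w | (X w < Y w)%E]) =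
  pr P [set w | (rv_min X Y w <= t%:E)%E] * pr P [set w | (X w < Y w)%E].
Proof.
move=> mX mY indep [lambda l0 XE] [mu m0 YE] XY0.
have indepC := independent_rvC indep.
set Z := rv_min X Y; have mZ : measurable_fun setT Z by event_measurable.
pose A := [set w | (X w < Y w)%E]; pose B := [set w | (Y w < X w)%E].
have mA : measurable A by rewrite /A; event_measurable.
have mB : measurable B by rewrite /B; event_measurable.
rewrite -/A; set K := lambda + mu; have K0 : 0 < K by rewrite addr_gt0.
have tailZ v (v0 : 0 <= v) : tail P Z (gg v) = expR (- (K * v)).
  exact: (tail_min_gg mX mY indep l0 m0 XE YE v0).
have tri C : measurable C -> pr P C = pr P (C `&` A) + pr P (C `&` B).
  move=> mC; rewrite (pr_trichotomy P mX mY mC) -/A -/B.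
  suff -> : pr P (C `&` [set w | X w = Y w]) = 0 by rewrite addr0.
  apply/eqP; rewrite eq_le pr_ge0 andbT -[leRHS]XY0.
  by apply: le_pr => [| |w []//]; event_measurable.
have sumc : lambda / K + mu / K = 1 by rewrite /K; field; rewrite gt_eqF.
have causes v : 0 <= v ->
    pr P ([set w | (Z w <= gg v)%E] `&` A) =
      lambda / K * (1 - expR (- (K * v))) /\
    pr P ([set w | (Z w <= gg v)%E] `&` B) = mu / K * (1 - expR (- (K * v))).
  move=> v0; have := exponential_cause_le mX mY indep l0 m0 XE YE v0.
  have := exponential_cause_le mY mX indepC m0 l0 YE XE v0.
  rewrite rv_minC (addrC mu) -/A -/B -/Z -/K.
  have mC : measurable [set w | (Z w <= gg v)%E] by event_measurable.
  have := tri _ mC.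
  rewrite pr_le_tail// tailZ//.
  set e := 1 - _ => eE; have : lambda / K * e + mu / K * e = e.
    by rewrite -mulrDl sumc mul1r.
  by split; lra.
(* The lower bounds [c * (1 - expR (- (K * v)))] of [P C] approach [c] as [v] grows. *)
have ge_cause C c : 0 < c -> measurable C -> (forall v, 0 <= v ->
    pr P ([set w | (Z w <= gg v)%E] `&` C) = c * (1 - expR (- (K * v)))) ->
    c <= pr P C.
  move=> c0 mC CE; have : (c - pr P C) / c <= 0.
    apply: (expR_lower_bound_le0 K0) => v v0.
    rewrite ler_pdivrMr// lerBlDr -lerBlDl.
    have := CE _ (ltW v0).
    have : pr P ([set w | (Z w <= gg v)%E] `&` C) <= pr P C.
      by apply: le_pr => [| |w []//]; event_measurable.
    lra.
  by rewrite pmulr_lle0 ?invr_gt0// subr_le0.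
(* The lower bounds [lambda / K] and [mu / K] already sum to 1. *)
have prA : pr P A = lambda / K.
  have := tri _ measurableT; rewrite pr_setT !setTI.
  have := ge_cause _ _ (divr_gt0 l0 K0) mA (fun v v0 => (causes v v0).1).
  have := ge_cause _ _ (divr_gt0 m0 K0) mB (fun v v0 => (causes v v0).2).
  lra.
have : tail P Z t%:E = 0 \/
    exists2 u, 0 <= u & tail P Z t%:E = expR (- (K * u)).
  rewrite tail_rv_min//.
  have tX := tail_g_exponential mX t%:E XE.
  have tY := tail_g_exponential mY t%:E YE.
  case: (image_law_tail t g_incr) => [z|[u u0 uE]].
    by left; move: tX; rewrite z// => -[->]; rewrite mul0r.
  right; exists u => //; move: tX tY; rewrite !uE// => -[->] [->].
  by rewrite -expRD; congr expR; rewrite /K; ring.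
have mZt : measurable [set w | (Z w <= t%:E)%E] by event_measurable.
(* Either [Z <= t] almost surely, or [t] can be traded for [gg u]. *)
case=> [t0|[u u0 tu]].
  have Zt1 : pr P [set w | (Z w <= t%:E)%E] = 1.
    by rewrite pr_le_tail// t0 subr0.
  rewrite Zt1 mul1r setIC; have := pr_splitI P mA mZt.
  suff -> : pr P (A `&` ~` [set w | (Z w <= t%:E)%E]) = 0 by rewrite addr0.
  apply/eqP; rewrite eq_le pr_ge0 andbT; apply: (@le_trans _ _
    (pr P (~` [set w | (Z w <= t%:E)%E]))); last by rewrite pr_setC// Zt1 subrr.
  by apply: le_pr => [| |w []//]; event_measurable.
have -> : pr P ([set w | (Z w <= t%:E)%E] `&` A) =
    pr P ([set w | (Z w <= gg u)%E] `&` A).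
  (* Between two points of equal tail [Z] has no mass. *)
  have null s s' : (s <= s')%E -> tail P Z s = tail P Z s' ->
      pr P ([set w | (Z w <= s')%E] `&` A) =
      pr P ([set w | (Z w <= s)%E] `&` A).
    move=> ss' sE; apply/eqP; rewrite -subr_eq0 pr_le_setI_diff//.
    rewrite eq_le pr_ge0 andbT.
    have : pr P [set w | (s < Z w)%E /\ (Z w <= s')%E] <= 0.
      by rewrite pr_itv_oc// sE subrr.
    apply: le_trans; apply: le_pr => [| |w []//]; last first.
      by apply: measurableI; event_measurable.
    by apply: measurableI => //; apply: measurableI; event_measurable.
  have E : tail P Z t%:E = tail P Z (gg u) by rewrite tu tailZ.
  by case: (leP t%:E (gg u)) => [|/ltW] tg; [symmetry|]; apply: null.
by rewrite (causes u u0).1 prA pr_le_tail// tu mulrC.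
Qed.

End ExponentialTimeCause.

Lemma indep_of_event_pr d (T : measurableType d) (R : realType)
    (P : probability T R) (Z : T -> \bar R) (A : set T) :
  measurable_fun setT Z -> measurable A ->
  (forall t : R, pr P ([set w | (Z w <= t%:E)%E] `&` A) =
                 pr P [set w | (Z w <= t%:E)%E] * pr P A) ->
  indep_of_event P Z A.
Proof.
move=> mZ mA ZA t.
by rewrite !prE; [rewrite ZA EFinM|event_measurable..].
Qed.

Lemma time_cause_independentC d (T : measurableType d) (R : realType)
    (P : probability T R) (X Y : T -> \bar R) :
  time_cause_independent P X Y -> time_cause_independent P Y X.
Proof.
rewrite /time_cause_independent (rv_minC Y) => -[gt lt eq]; split=> //.
by rewrite event_eqC.
Qed.

Lemma as_finite_rv_min d (T : measurableType d) (R : realType)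
    (P : probability T R) (X Y : T -> \bar R) :
  as_finite P X -> as_finite P Y -> as_finite P (rv_min X Y).
Proof.
rewrite /as_finite; apply: filterS2 => w Xw Yw.
by rewrite /rv_min; case: leP.
Qed.

(** * Atoms of the minimum *)

Section MinimumAtoms.
Context d (T : measurableType d) (R : realType) (P : probability T R).
Variables X Y : T -> \bar R.
Hypotheses (mX : measurable_fun setT X) (mY : measurable_fun setT Y).
Hypothesis indep : independent_rv P X Y.
Local Notation Z := (rv_min X Y).

Lemma pr_min_atom_lt (t : \bar R) :
  pr P ([set w | Z w = t] `&` [set w | (X w < Y w)%E]) =
  pr P [set w | X w = t] * tail P Y t.
Proof.
have m1 : measurable [set x : \bar R | x = t] by event_measurable.
have m2 : measurable [set x : \bar R | (t < x)%E] by event_measurable.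
rewrite /tail -(pr_indep mX mY indep m1 m2).
congr (pr P _); apply/seteqP; split=> w /=; rewrite /rv_min.
  by case=> Zt XY; move: Zt; rewrite min_l ?ltW// => <-.
by case=> Xt tY; rewrite Xt min_l ?ltW.
Qed.

Lemma pr_min_atom_eq (t : \bar R) :
  pr P ([set w | Z w = t] `&` [set w | X w = Y w]) =
  pr P [set w | X w = t] * pr P [set w | Y w = t].
Proof.
have m1 : measurable [set x : \bar R | x = t] by event_measurable.
rewrite -(pr_indep mX mY indep m1 m1).
congr (pr P _); apply/seteqP; split=> w /=; rewrite /rv_min.
  by case=> Zt XY; move: Zt; rewrite XY; rewrite minxx.
by case=> Xt Yt; rewrite Xt Yt minxx.
Qed.

End MinimumAtoms.

(** * Consequences of independence of time and cause *)

Section TimeCauseInequalities.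
Context d (T : measurableType d) (R : realType) (P : probability T R).
Variables X Y : T -> \bar R.
Hypotheses (mX : measurable_fun setT X) (mY : measurable_fun setT Y).
Hypothesis indep : independent_rv P X Y.
Hypothesis tci : time_cause_independent P X Y.
Local Notation Z := (rv_min X Y).
Local Notation p := (pr P [set w | (X w < Y w)%E]).
Local Notation r := (pr P [set w | X w = Y w]).

Let mZ : measurable_fun setT Z. Proof. by event_measurable. Qed.

Lemma pr_min_lt (B : set (\bar R)) : measurable B ->
  pr P (Z @^-1` B `&` [set w | (X w < Y w)%E]) = pr P (Z @^-1` B) * p.
Proof.
by case: tci => _ lt _; apply: indep_of_event_preimage => //; event_measurable.
Qed.

Lemma pr_min_eq (B : set (\bar R)) : measurable B ->
  pr P (Z @^-1` B `&` [set w | X w = Y w]) = pr P (Z @^-1` B) * r.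
Proof.
by case: tci => _ _ eq; apply: indep_of_event_preimage => //; event_measurable.
Qed.

Let measurable_oc (s t : \bar R) : measurable [set x | (s < x)%E /\ (x <= t)%E].
Proof. by apply: measurableI; event_measurable. Qed.

(** If [s < X <= t < Y], then [X < Y] and [Z = X] lies in the interval; independence of time and
    cause evaluates this larger event. *)
Lemma tail_drop_le (s t : \bar R) : (s <= t)%E ->
  tail P Y t * (tail P X s - tail P X t) <= p * (tail P Z s - tail P Z t).
Proof.
move=> st; rewrite mulrC [leRHS]mulrC -!pr_itv_oc//.
rewrite -(pr_min_lt (measurable_oc s t)) /tail.
rewrite -(pr_indep mX mY indep (measurable_oc s t) (B := [set x | (t < x)%E]));
  last by event_measurable.
apply: le_pr.
- apply: measurableI; last by event_measurable.
  by apply: measurable_preimageT => //; exact: measurable_oc.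
- apply: measurableI; last by event_measurable.
  by apply: measurable_preimageT => //; exact: measurable_oc.
- move=> w [[/= sX Xt] /= tY]; have XY := le_lt_trans Xt tY.
  by rewrite /rv_min min_l ?(ltW XY).
Qed.

(** Where [X = Y] and [Z] lies in the interval, so do both [X] and [Y]. *)
Lemma tail_drop_mul_ge (s t : \bar R) : (s <= t)%E ->
  r * (tail P Z s - tail P Z t) <=
  (tail P X s - tail P X t) * (tail P Y s - tail P Y t).
Proof.
move=> st; rewrite mulrC -!pr_itv_oc//.
rewrite -(pr_min_eq (measurable_oc s t)).
rewrite -(pr_indep mX mY indep (measurable_oc s t) (measurable_oc s t)).
have mI := measurable_oc s t.
apply: le_pr; [by event_measurable|by event_measurable|].
move=> w [/= + /= XY]; rewrite /rv_min XY minxx => -[sY Yt].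
by [].
Qed.

(** The mass of [{Z = t, X < Y}] computed twice: by independence of [X] and [Y], and by independence
    of time and cause. *)
Lemma pr_atom_lt (t : \bar R) :
  pr P [set w | X w = t] * tail P Y t = p * pr P [set w | Z w = t].
Proof.
rewrite -pr_min_atom_lt// mulrC -(pr_min_lt (B := [set x | x = t]))//.
by event_measurable.
Qed.

Lemma pr_atom_eq (t : \bar R) :
  pr P [set w | X w = t] * pr P [set w | Y w = t] =
  r * pr P [set w | Z w = t].
Proof.
rewrite -pr_min_atom_eq// mulrC -(pr_min_eq (B := [set x | x = t]))//.
by event_measurable.
Qed.

(* With [F], [G], [H = F G] the tails of [X], [Y], [Z], the inequality
   [tail_drop_le] says [F s / F t - 1 <= p (H s / H t - 1)]; this bounds the
   increments of [- ln F] along a parametrization of the line in which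
   [- ln H] is the parameter. *)
Lemma tail_ge_expR (gg : R -> \bar R) :
  (forall s t, 0 <= s -> s <= t -> (gg s <= gg t)%E) ->
  (forall v, 0 <= v -> tail P Z (gg v) = expR (- v)) ->
  forall v, 0 <= v -> expR (- (p * v)) <= tail P X (gg v).
Proof.
move=> gg_le tailZ.
have tailXY v : 0 <= v -> tail P X (gg v) * tail P Y (gg v) = expR (- v).
  by move=> v0; rewrite -tail_rv_min// tailZ.
have tailX_gt0 v : 0 <= v -> 0 < tail P X (gg v).
  move=> v0; rewrite lt_neqAle tail_ge0 andbT; apply/eqP => Xv0.
  by have := tailXY _ v0; rewrite -Xv0 mul0r => /eqP; rewrite lt_eqF// expR_gt0.
pose h v := - ln (tail P X (gg v)).
(* Two tails, each at most 1, whose product is 1 are both 1. *)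
have h0 : h 0 = 0.
  have := tailXY 0 (lexx _); rewrite oppr0 expR0.
  have := tail_le1 P mX (gg 0); have := tail_le1 P mY (gg 0).
  move=> Y1 X1 XY1; rewrite /h (_ : tail P X (gg 0) = 1) ?ln1 ?oppr0//.
  apply/eqP; rewrite eq_le X1 -XY1 ler_piMr// tail_ge0//.
have bound : forall s t : R, 0 <= s -> s <= t -> h t - h s <= p * (t - s).
  apply: (increment_bound (K := 1)) => s t s0 st.
  have t0 := le_trans s0 st.
  have Xs := tailX_gt0 _ s0; have Xt := tailX_gt0 _ t0.
  rewrite /h opprK addrC -lnV ?posrE// -lnM ?posrE ?invr_gt0//.
  (* Here [ln x <= x - 1] is applied to the ratio of tails; [expR_sub1_le] then costs a factor
     [expR (t - s)], which [increment_bound] removes. *)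
  rewrite -(subrK 1 (_ / _)) addrC; apply: le_trans (le_ln1Dx _) _.
    by rewrite ltrBrDr addNr divr_gt0.
  have := tail_drop_le (gg_le _ _ s0 st); rewrite !tailZ//.
  have -> : tail P Y (gg t) = expR (- t) / tail P X (gg t).
    by rewrite -tailXY// mulrC mulKf ?gt_eqF.
  have -> : expR (- s) = expR (- t) * expR (t - s).
    by rewrite -expRD; congr expR; ring.
  have -> : expR (- t) / tail P X (gg t) * (tail P X (gg s) - tail P X (gg t))
      = expR (- t) * (tail P X (gg s) / tail P X (gg t) - 1).
    by field; rewrite gt_eqF.
  rewrite -[X in p * (_ - X)]mulr1 -mulrBr mulrCA ler_pM2l ?expR_gt0//.
  move=> /le_trans; apply; rewrite mul1r -mulrA ler_wpM2l ?pr_ge0//.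
  by rewrite [leRHS]mulrC; exact: expR_sub1_le.
move=> v v0; have := bound 0 v (lexx _) v0.
rewrite h0 !subr0 /h => lnX.
by rewrite -[leRHS]lnK ?posrE ?tailX_gt0// ler_expR; lra.
Qed.

End TimeCauseInequalities.

(** * Independence of time and cause without ties yields exponential laws *)

Section ExponentialFromTimeCause.
Context d (T : measurableType d) (R : realType) (P : probability T R).
Variables X Y : T -> \bar R.
Hypotheses (mX : measurable_fun setT X) (mY : measurable_fun setT Y).
Hypotheses (fX : as_finite P X) (fY : as_finite P Y).
Hypothesis indep : independent_rv P X Y.
Hypothesis tci : time_cause_independent P X Y.
Local Notation Z := (rv_min X Y).
Local Notation p := (pr P [set w | (X w < Y w)%E]).
Local Notation q := (pr P [set w | (Y w < X w)%E]).
Hypotheses (p_gt0 : 0 < p) (q_gt0 : 0 < q).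
Hypothesis r0 : pr P [set w | X w = Y w] = 0.

Let mZ : measurable_fun setT Z. Proof. by event_measurable. Qed.
Let fZ : as_finite P Z. Proof. exact: as_finite_rv_min. Qed.
Let indepC := independent_rvC indep.
Let tciC := time_cause_independentC tci.

(** As [p] and [q] are positive, an atom of [Z] would be an atom of both [X] and [Y], and ties would
    have positive probability. *)
Let min_atomless (t : \bar R) : pr P [set w | Z w = t] = 0.
Proof.
apply/eqP; rewrite eq_le pr_ge0 andbT leNgt; apply/negP => Zt.
have XtYt := pr_atom_eq mX mY indep tci t.
have Xt := pr_atom_lt mX mY indep tci t.
have Yt := pr_atom_lt mY mX indepC tciC t.
rewrite r0 mul0r in XtYt; rewrite -rv_minC in Yt.
have pZ : 0 < p * pr P [set w | Z w = t] by rewrite mulr_gt0.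
have qZ : 0 < q * pr P [set w | Z w = t] by rewrite mulr_gt0.
move/eqP : XtYt; rewrite mulf_eq0 => /orP[] /eqP zero.
  by move: pZ; rewrite -Xt zero mul0r ltxx.
by move: qZ; rewrite -Yt zero mul0r ltxx.
Qed.

(** Without atoms the tail is continuous, so the quantile reaches its level exactly. *)
Let tail_min_quantile u : 0 < u < 1 -> tail P Z (upper_quantile P Z u)%:E = u.
Proof.
move=> u01; apply/eqP; rewrite eq_le -(upper_quantile_le mZ fZ)// lexx/=.
have := pr_ge_tail P mZ (upper_quantile P Z u)%:E.
rewrite min_atomless add0r => <-; apply: tail_left_le => // s sQ.
rewrite leNgt; apply/negP => /ltW; rewrite -(upper_quantile_le mZ fZ)//.
by rewrite leNgt sQ.
Qed.

Let g (v : R) := upper_quantile P Z (expR (- v)).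
Let gg (v : R) : \bar R := if 0 < v then (g v)%:E else -oo%E.

Let expRN01 (v : R) : 0 < v -> 0 < expR (- v) < 1.
Proof. by move=> v0; rewrite expR_gt0/= expR_lt1 oppr_lt0. Qed.

Let tail_min_g v : 0 < v -> tail P Z (g v)%:E = expR (- v).
Proof. by move=> v0; rewrite tail_min_quantile// expRN01. Qed.

Let tail_min_gg v : 0 <= v -> tail P Z (gg v) = expR (- v).
Proof.
rewrite le_eqVlt /gg => /predU1P[<-|v0]; last by rewrite v0 tail_min_g.
by rewrite ltxx tailNy// oppr0 expR0.
Qed.

Let g_incr : @strictly_increasing_pos R g.
Proof.
move=> u v u0 uv; have v0 := lt_trans u0 uv; rewrite ltNge; apply/negP => gvu.
have : tail P Z (g u)%:E <= tail P Z (g v)%:E.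
  by apply: le_tail => //; rewrite lee_fin.
by rewrite !tail_min_g// ler_expR lerN2 leNgt uv.
Qed.

Let gg_le s t : 0 <= s -> s <= t -> (gg s <= gg t)%E.
Proof.
rewrite /gg => s0; rewrite le_eqVlt => /predU1P[->//|st].
rewrite (le_lt_trans s0 st); case: ifP => // s0'; rewrite ?leNye//.
by rewrite lee_fin ltW// g_incr.
Qed.

Let pq1 : p + q = 1.
Proof.
by have := pr_trichotomy P mX mY measurableT; rewrite !setTI r0 addr0 pr_setT.
Qed.

(** Each tail is at least its exponential, while the two products are equal; hence both bounds are
    equalities. *)
Let tails_gg v : 0 <= v ->
  tail P X (gg v) = expR (- (p * v)) /\ tail P Y (gg v) = expR (- (q * v)).
Proof.
move=> v0.
have Xv := tail_ge_expR mX mY indep tci gg_le tail_min_gg v0.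
have Yv : expR (- (q * v)) <= tail P Y (gg v).
  by apply: tail_ge_expR => //; rewrite -rv_minC.
have : tail P X (gg v) * tail P Y (gg v) = expR (- (p * v)) * expR (- (q * v)).
  rewrite -tail_rv_min// tail_min_gg// -expRD; congr expR.
  by rewrite -opprD -mulrDl pq1 mul1r.
have := expR_gt0 (- (p * v)); have := expR_gt0 (- (q * v)).
move: Xv Yv; set a := expR _; set b := expR _.
set F := tail P X _; set G := tail P Y _.
by move=> aF bG b0 a0 FG; split; nra.
Qed.

(** The points [gg v] may miss parts of the line that [Z] does not charge. While the tail of [Z] is
    positive, [Wconst] carries the value of the tail of [W] from [gg w] to [t], where [w] is minus
    the logarithm of the tail of [Z] at [t]. *)
Let tail_law (c : R) (W : T -> \bar R) : measurable_fun setT W -> 0 < c ->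
  (forall v, 0 <= v -> tail P W (gg v) = expR (- (c * v))) ->
  (forall s t, (s <= t)%E -> 0 < tail P Z s -> tail P Z s = tail P Z t ->
    tail P W s = tail P W t) ->
  forall t : R, (tail P W t%:E)%:E =
     exponential_prob c [set v | 0 < v /\ t < g v].
Proof.
move=> mW c0 Wgg Wconst t.
have gt v : 0 < v -> (t < g v) = (expR (- v) < tail P Z t%:E).
  by move=> v0; rewrite !ltNge (upper_quantile_le mZ fZ)// expRN01.
have := tail_ge0 P Z t%:E; rewrite le_eqVlt => /predU1P[Zt0|Zt0].
  (* Here [t] is at or beyond every [g v], so the tail of [W] at [t] is below every
     [expR (- (c * v))]. *)
  rewrite (_ : [set v | _] = set0); last first.
    apply/seteqP; split=> v //= [v0]; rewrite gt// -Zt0.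
    by rewrite ltNge expR_ge0.
  rewrite /exponential_prob integral_set0; congr _%:E.
  apply/eqP; rewrite eq_le tail_ge0 andbT.
  apply: (expR_lower_bound_le0 c0) => v v0.
  rewrite -Wgg; last exact: ltW.
  apply: le_tail => //; rewrite /gg v0 lee_fin.
  by rewrite leNgt gt// -Zt0 ltNge expR_ge0.
pose w := - ln (tail P Z t%:E).
have w0 : 0 <= w by rewrite oppr_ge0 ln_le0// tail_le1.
have Ztw : tail P Z t%:E = expR (- w) by rewrite opprK lnK.
rewrite (_ : [set v | _] = [set v | w < v]); last first.
  apply/seteqP; split=> v /=.
    by case=> v0; rewrite gt// Ztw ltr_expR ltrN2.
  by move=> wv; have v0 := le_lt_trans w0 wv; rewrite gt// Ztw ltr_expR ltrN2.
rewrite exponential_prob_tail// -Wgg//; congr _%:E; symmetry; apply: Wconst.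
- rewrite /gg; case: ifP => [w0'|]; last by rewrite leNye.
  by rewrite lee_fin leNgt gt// Ztw ltxx.
- by rewrite tail_min_gg// expR_gt0.
- by rewrite tail_min_gg.
Qed.

Lemma exponential_of_time_cause_independent :
  exists g : R -> R, strictly_increasing_pos g /\
    g_exponential P g X /\ g_exponential P g Y.
Proof.
exists g; split=> //.
(* If a positive product of two nonincreasing factors does not drop, neither factor does. *)
have const s t : (s <= t)%E -> 0 < tail P Z s -> tail P Z s = tail P Z t ->
    tail P X s = tail P X t /\ tail P Y s = tail P Y t.
  move=> st; rewrite !tail_rv_min//.
  have := le_tail P mX st; have := le_tail P mY st.
  have := tail_ge0 P X t; have := tail_ge0 P Y t.
  set a := tail P X s; set b := tail P Y s.
  set a' := tail P X t; set b' := tail P Y t.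
  move=> b0 a0 ba aa ab0 abE.
  have a_neq0 : a != 0 by apply/eqP => a00; rewrite a00 mul0r ltxx in ab0.
  have b_neq0 : b != 0 by apply/eqP => b00; rewrite b00 mulr0 ltxx in ab0.
  have := ler_wpM2l a0 ba; have := ler_wpM2r b0 aa.
  have := ler_wpM2r (le_trans b0 ba) aa; have := ler_wpM2l (le_trans a0 aa) ba.
  by split; [apply: (mulIf b_neq0)|apply: (mulfI a_neq0)]; lra.
split; [apply: (g_exponential_of_tail g_incr mX p_gt0)|
        apply: (g_exponential_of_tail g_incr mY q_gt0)].
- apply: tail_law => // [v v0|s t st Zs ZE]; first by have [] := tails_gg v0.
  by have [] := const _ _ st Zs ZE.
- apply: tail_law => // [v v0|s t st Zs ZE]; first by have [] := tails_gg v0.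
  by have [] := const _ _ st Zs ZE.
Qed.

End ExponentialFromTimeCause.

(** * The geometric case *)

Section GeometricLaw.
Context d (T : measurableType d) (R : realType) (P : probability T R).
Variables (Z : T -> \bar R) (a : nat -> R) (alpha : R).
Hypothesis mZ : measurable_fun setT Z.
Hypothesis a_incr : forall k, a k < a k.+1.
Hypothesis alpha01 : 0 < alpha < 1.
Hypothesis mass : forall k,
  pr P [set w | Z w = (a k)%:E] = alpha * (1 - alpha) ^+ k.

Let atom k := [set w | Z w = (a k)%:E].

Let measurable_atom k : measurable (atom k).
Proof. by rewrite /atom; event_measurable. Qed.

Let a_le m n : (m <= n)%N -> a m <= a n.
Proof.
move=> mn; apply: (homo_leq (r := <=%R)) mn => [x|y x z|k];
  [exact: lexx|exact: le_trans|exact/ltW].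
Qed.

Let a_lt m n : (m < n)%N -> a m < a n.
Proof. by move=> mn; exact: lt_le_trans (a_incr m) (a_le mn). Qed.

Let trivIset_atom (E : set T) : trivIset setT (fun k => E `&` atom k).
Proof.
apply/trivIsetP => i j _ _ ij; apply/seteqP; split=> w //= [[_ Zi] [_ Zj]].
have aij : a i = a j by apply: EFin_inj; rewrite -Zi -Zj.
by case: (ltngtP i j) ij => // /a_lt; rewrite aij ltxx.
Qed.

(** The masses form a geometric series with sum 1, so the atoms carry the whole law. *)
Let bigcup_atom : P (\bigcup_k atom k) = 1%E.
Proof.
have tI : trivIset setT atom.
  have := @trivIset_atom setT; congr trivIset.
  by apply/funext => k; rewrite setTI.
rewrite measure_semi_bigcup//; last exact: bigcupT_measurable.
have /andP[alpha0 alpha1] := alpha01.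
have lt1 : `|1 - alpha| < 1 by rewrite ger0_norm; lra.
have := @cvg_geometric_series R alpha _ lt1.
rewrite subKr mulfV ?gt_eqF//.
move=> /cvg_lim <-//.
rewrite -EFin_lim; last first.
  exact: is_cvg_geometric_series.
by congr (limn _); apply/funext => n /=; rewrite /series/= -sumEFin;
  apply: eq_bigr => k _; rewrite prE// mass.
Qed.

Lemma atoms_null E : measurable E ->
  (forall k, E `&` [set w | Z w = (a k)%:E] = set0) -> pr P E = 0.
Proof.
move=> mE E0; have mU := bigcupT_measurable _ measurable_atom.
have : pr P (~` \bigcup_k atom k) = 0.
  by rewrite pr_setC// /pr bigcup_atom subrr.
move=> U0; apply/eqP; rewrite eq_le pr_ge0 andbT -[leRHS]U0.
apply: le_pr => //; first exact: measurableC.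
by move=> w Ew [k _ Zw]; have : (E `&` atom k) w by []; rewrite E0.
Qed.

Lemma pr_atoms E : measurable E ->
  P E = (\sum_(0 <= k <oo) P (E `&` [set w | Z w = (a k)%:E]))%E.
Proof.
move=> mE; have mU := bigcupT_measurable _ measurable_atom.
have mEk k : measurable (E `&` atom k) by exact: measurableI.
transitivity (P (E `&` \bigcup_k atom k)); last first.
  rewrite setI_bigcupr; apply: measure_semi_bigcup => //.
  exact: bigcupT_measurable.
rewrite !prE//; last exact: measurableI.
rewrite (pr_splitI P mE mU) [X in _ + X](_ : _ = 0) ?addr0//.
apply: atoms_null => [|k].
  by apply: measurableI => //; exact: measurableC.
apply/seteqP; split=> w // [[_ nU] Zw]; apply: nU; by exists k.
Qed.

Lemma pr_ge_atom0 : pr P [set w | ((a 0)%:E <= Z w)%E] = 1.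
Proof.
have mA : measurable [set w | ((a 0)%:E <= Z w)%E] by event_measurable.
apply/eqP; rewrite -[eqbLHS]opprK -subr_eq0 -opprD oppr_eq0 addrC -pr_setC//.
apply/eqP; apply: atoms_null => [|k]; first exact: measurableC.
by apply/seteqP; split=> w // [/= + Zk]; rewrite Zk lee_fin a_le.
Qed.

(** No mass lies between consecutive atoms, so [P (Z >= a k.+1)] is the tail at [a k]; removing the
    atom gives the recursion. *)
Lemma tail_atom k : tail P Z (a k)%:E = (1 - alpha) ^+ k.+1.
Proof.
have ge_atomS m : pr P [set w | ((a m.+1)%:E <= Z w)%E] = tail P Z (a m)%:E.
  have am : ((a m)%:E < (a m.+1)%:E)%E by rewrite lte_fin.
  have := pr_itv_oo P mZ am; rewrite (atoms_null (E := [set w | _ /\ _]));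
    first by move=> {am} ?; lra.
    by apply: measurableI; event_measurable.
  move=> j; apply/seteqP; split=> w // [/= [+ +] Zj]; rewrite Zj !lte_fin.
  case: (leqP j m) => [/a_le ajm|/a_le ajm] aj aj'.
    by rewrite ltNge ajm in aj.
  by rewrite ltNge ajm in aj'.
have tailE m := pr_ge_tail P mZ (a m)%:E.
elim: k => [|k IHk].
  by have := tailE 0%N; rewrite pr_ge_atom0 mass expr0 expr1; lra.
have := tailE k.+1; rewrite ge_atomS IHk mass => H.
by rewrite [RHS]exprS; lra.
Qed.

(** Summing over the atoms extends the ratio [c] to every event determined by [Z]. *)
Lemma atoms_indep (A : set T) (c : R) : measurable A -> 0 <= c ->
  (forall k, pr P ([set w | Z w = (a k)%:E] `&` A) =
             c * pr P [set w | Z w = (a k)%:E]) ->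
  indep_of_event P Z A.
Proof.
move=> mA c0 Ac.
have key (B : set (\bar R)) : measurable B ->
    P (Z @^-1` B `&` A) = (c%:E * P (Z @^-1` B))%E.
  move=> mB; have mZB := measurable_preimageT mZ mB.
  rewrite (pr_atoms (E := Z @^-1` B `&` A)); last exact: measurableI.
  rewrite (pr_atoms mZB) -nneseriesZl//.
  apply: eq_eseriesr => k _; have [Bk|nBk] := pselect (B (a k)%:E).
    have Bak : Z @^-1` B `&` atom k = atom k.
      by apply/seteqP; split=> w /= => [[]//|Zw]; rewrite /preimage/= Zw.
    rewrite setIAC Bak !prE ?Ac//; exact: measurableI.
  have B0 : Z @^-1` B `&` atom k = set0.
    by apply/seteqP; split=> w // [/= + Zw]; rewrite Zw.
  by rewrite setIAC B0 set0I measure0 mule0.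
(* The whole line as test set identifies [c] with [P A]. *)
move=> t; have := key _ measurableT.
rewrite preimage_setT setTI probability_setT mule1 => ->; rewrite muleC.
apply: (key [set x | (x <= t%:E)%E]).
by event_measurable.
Qed.

End GeometricLaw.

(** * Geometric laws described by their point masses *)

Section GGeometric.
Context d (T : measurableType d) (R : realType) (P : probability T R).
Variables (g : R -> R) (Z : T -> \bar R).
Hypothesis g_incr : strictly_increasing_pos g.
Hypothesis mZ : measurable_fun setT Z.

Let a k := g k.+1%:R.

Let a_incr k : a k < a k.+1.
Proof. by apply: g_incr; rewrite ?ltr0n// ltr_nat. Qed.

Let image_lawE (alpha : R) (B : set (\bar R)) : 0 < alpha < 1 ->
  image_law g (geometric_prob alpha) B =
  (\sum_(0 <= k <oo) (alpha * (1 - alpha) ^+ k)%:E * \d_((a k)%:E) B)%E.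
Proof.
move=> /andP[a0 a1]; rewrite /image_law /geometric_prob -(nneseries_addn 1).
  apply: eq_eseriesr => k _; rewrite addn1 /=; congr (_ * _)%E.
  rewrite !diracE; congr (_%:R%:E); congr nat_of_bool.
  by apply/idP/idP; rewrite !inE /=; [case|split=> //; rewrite ltr0n].
by move=> k; rewrite mule_ge0// lee_fin mulr_ge0 ?exprn_ge0//; lra.
Qed.

(** The point masses determine the law because they sum to 1. The geometric variable starts at 1, so
    the atom of index [k] is [g k.+1%:R]. *)
Lemma g_geometricP : g_geometric P g Z <->
  exists2 alpha, 0 < alpha < 1 &
    forall k, pr P [set w | Z w = (g k.+1%:R)%:E] = alpha * (1 - alpha) ^+ k.
Proof.
split=> -[alpha a01 H]; exists alpha => //.
  move=> k; apply: EFin_inj; rewrite -prE; last by event_measurable.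
  have m1 : measurable [set x : \bar R | x = (g k.+1%:R)%:E].
    by event_measurable.
  rewrite [LHS](H _ m1) image_lawE// (nneseriesD1 (n := k))//.
    rewrite eseries0 ?adde0; first by rewrite diracE mem_set// mule1.
    move=> j _ /= jk; rewrite diracE memNset ?mule0//= => jk_eq.
    have ajk : a j = a k by exact: EFin_inj.
    have aS m n : (m < n)%N -> a m < a n.
      by move=> mn; apply: g_incr; rewrite ?ltr0n// ltr_nat.
    by case: (ltngtP j k) jk => // /aS; rewrite ajk ltxx.
  case/andP: a01 => al0 al1 j _; rewrite mule_ge0// lee_fin.
  by rewrite mulr_ge0 ?exprn_ge0//; lra.
move=> B mB; rewrite image_lawE//.
have mZB := measurable_preimageT mZ mB.
rewrite (pr_atoms mZ a_incr a01 H mZB).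
apply: eq_eseriesr => k _; rewrite diracE.
have mk : measurable [set w | Z w = (a k)%:E] by event_measurable.
have [Bk|nBk] := pselect (B (a k)%:E).
  rewrite mem_set// mule1 -H -prE//; congr (P _).
  by apply/seteqP; split=> w /= => [[]//|Zw]; rewrite /preimage/= Zw.
rewrite memNset// mule0 (_ : _ `&` _ = set0) ?measure0//.
by apply/seteqP; split=> w // [/= + Zw]; rewrite Zw.
Qed.

End GGeometric.

(** * Geometric laws imply independence of time and cause *)

Section GeometricTimeCause.
Context d (T : measurableType d) (R : realType) (P : probability T R).
Variables (g : R -> R) (X Y : T -> \bar R).
Hypothesis g_incr : strictly_increasing_pos g.
Hypotheses (mX : measurable_fun setT X) (mY : measurable_fun setT Y).
Hypothesis indep : independent_rv P X Y.
Hypotheses (XG : g_geometric P g X) (YG : g_geometric P g Y).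
Local Notation Z := (rv_min X Y).

Let a k := g k.+1%:R.

Let a_incr k : a k < a k.+1.
Proof. by apply: g_incr; rewrite ?ltr0n// ltr_nat. Qed.

Let mZ : measurable_fun setT Z. Proof. by event_measurable. Qed.

Let masses (C : set T) (c rho : R) := forall k,
  pr P ([set w | Z w = (a k)%:E] `&` C) = c * rho ^+ k.

(** All three masses decay at the same rate [rho], the product of the two failure probabilities, so
    their ratios do not depend on [k]. *)
Let min_masses : exists rho, 0 < rho < 1 /\ exists c1 c2 c3,
  [/\ 0 <= c1, 0 <= c2 & 0 <= c3] /\
  [/\ masses [set w | (X w < Y w)%E] c1 rho,
      masses [set w | (Y w < X w)%E] c2 rho,
      masses [set w | X w = Y w] c3 rho &
      forall k, pr P [set w | Z w = (a k)%:E] = (1 - rho) * rho ^+ k].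
Proof.
have [alpha a01 Xa] := (g_geometricP P g_incr mX).1 XG.
have [beta b01 Yb] := (g_geometricP P g_incr mY).1 YG.
have tX k := tail_atom mX a_incr a01 Xa k.
have tY k := tail_atom mY a_incr b01 Yb k.
have /andP[a0 a1] := a01; have /andP[b0 b1] := b01.
have a'0 : 0 < 1 - alpha by lra.
have b'0 : 0 < 1 - beta by lra.
have ab' : 0 < (1 - alpha) * (1 - beta) by exact: mulr_gt0.
exists ((1 - alpha) * (1 - beta)); split; first by apply/andP; split => //; nra.
(* A strict order costs one more failure of the later variable than a tie does. The three constants
   sum to [1 - rho]. *)
exists (alpha * (1 - beta)), (beta * (1 - alpha)), (alpha * beta).
split; first by split; rewrite mulr_ge0// ltW.
have m1 : masses [set w | (X w < Y w)%E] (alpha * (1 - beta))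
    ((1 - alpha) * (1 - beta)).
  by move=> k; rewrite pr_min_atom_lt// Xa tY exprMn exprS; ring.
have m2 : masses [set w | (Y w < X w)%E] (beta * (1 - alpha))
    ((1 - alpha) * (1 - beta)).
  move=> k; rewrite rv_minC pr_min_atom_lt//; last exact: independent_rvC.
  by rewrite Yb tX exprMn exprS; ring.
have m3 : masses [set w | X w = Y w] (alpha * beta)
    ((1 - alpha) * (1 - beta)).
  by move=> k; rewrite pr_min_atom_eq// Xa Yb exprMn; ring.
split=> // k.
have mk : measurable [set w | Z w = (a k)%:E] by event_measurable.
by rewrite (pr_trichotomy P mX mY mk) m1 m2 m3; ring.
Qed.

Lemma g_geometric_rv_min : g_geometric P g Z.
Proof.
have [rho [/andP[rho0 rho1] [_ [_ [_ [_ [_ _ _ mass]]]]]]] := min_masses.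
apply/(g_geometricP P g_incr mZ); exists (1 - rho).
  by apply/andP; split; lra.
by move=> k; rewrite mass subKr.
Qed.

Lemma geometric_time_cause_independent : time_cause_independent P X Y.
Proof.
have [rho [/andP[rho0 rho1] [c1 [c2 [c3 [[c10 c20 c30] H]]]]]] := min_masses.
have [m1 m2 m3 mass] := H.
have rho' : 0 < 1 - rho by lra.
have indepA (A : set T) (c : R) : measurable A -> 0 <= c ->
    masses A c rho ->
    indep_of_event P Z A.
  move=> mA c0 Ac.
  (* The ratio is taken against the atom mass [(1 - rho) * rho ^+ k]. *)
  apply: (@atoms_indep _ _ _ _ _ a (1 - rho) mZ a_incr _ _ A
    (c / (1 - rho))) => //.
  - by apply/andP; split; lra.
  - by move=> k; rewrite subKr mass.
  - by rewrite divr_ge0// ltW.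
  - by move=> k; rewrite mass Ac mulrA divfK ?gt_eqF.
split; [apply: (indepA _ c2)|apply: (indepA _ c1)|apply: (indepA _ c3)] => //;
  by event_measurable.
Qed.

End GeometricTimeCause.

(** * One step from a point to the next atom *)

Section AtomStep.
Context d (T : measurableType d) (R : realType) (P : probability T R).
Variables X Y : T -> \bar R.
Hypotheses (mX : measurable_fun setT X) (mY : measurable_fun setT Y).
Hypothesis indep : independent_rv P X Y.
Hypothesis tci : time_cause_independent P X Y.
Local Notation Z := (rv_min X Y).
Local Notation p := (pr P [set w | (X w < Y w)%E]).
Local Notation q := (pr P [set w | (Y w < X w)%E]).
Local Notation r := (pr P [set w | X w = Y w]).
Hypotheses (p_gt0 : 0 < p) (q_gt0 : 0 < q).

Let mZ : measurable_fun setT Z. Proof. by event_measurable. Qed.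

(** Since [Y > a] has positive probability, mass of [X] in the gap would give mass of [Z] there;
    hence [F s = P (X = a) + F a]. Comparing [P (Y = a) F a = q P (Z = a)] with
    [P (X = a) P (Y = a) = r P (Z = a)] gives [r F a = q P (X = a)]. *)
Lemma next_atom_tail (s a : \bar R) : (s < a)%E ->
  pr P [set w | (s < Z w)%E /\ (Z w < a)%E] = 0 ->
  0 < pr P [set w | Z w = a] ->
  tail P X a = q / (q + r) * tail P X s /\
  pr P [set w | X w = a] = (1 - q / (q + r)) * tail P X s.
Proof.
move=> sa Zsa Za.
have Xa := pr_atom_lt mX mY indep tci a.
have indepC := independent_rvC indep; have tciC := time_cause_independentC tci.
have Ya := pr_atom_lt mY mX indepC tciC a.
rewrite -rv_minC in Ya.
have XYa := pr_atom_eq mX mY indep tci a.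
have Xa0 := pr_ge0 P [set w | X w = a].
have tYa0 := tail_ge0 P Y a.
have Ya0 := pr_ge0 P [set w | Y w = a].
have r0 : 0 <= r by exact: pr_ge0.
have tYa : 0 < tail P Y a.
  rewrite lt_neqAle tYa0 andbT; apply/eqP => z; rewrite -z mulr0 in Xa.
  by have := mulr_gt0 p_gt0 Za; rewrite -Xa ltxx.
have Ya_gt0 : 0 < pr P [set w | Y w = a].
  rewrite lt_neqAle Ya0 andbT; apply/eqP => z; rewrite -z mul0r in Ya.
  by have := mulr_gt0 q_gt0 Za; rewrite -Ya ltxx.
have Xsa : pr P [set w | (s < X w)%E /\ (X w < a)%E] = 0.
  apply/eqP; rewrite eq_le pr_ge0 andbT -(pmulr_lle0 _ tYa) -[leRHS]Zsa.
  have mI : measurable [set x : \bar R | (s < x)%E /\ (x < a)%E].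
    by apply: measurableI; event_measurable.
  have mJ : measurable [set x : \bar R | (a < x)%E] by event_measurable.
  rewrite /tail -(pr_indep mX mY indep mI mJ).
  apply: le_pr; [by event_measurable| |].
    by apply: measurableI; event_measurable.
  move=> w [/= [sX Xa'] aY]; rewrite /rv_min min_l//.
  exact: ltW (lt_trans Xa' aY).
have := pr_itv_oo P mX sa; rewrite Xsa pr_ge_tail// => /esym/eqP.
rewrite subr_eq add0r => /eqP tX.
have rF : r * tail P X a = q * pr P [set w | X w = a].
  apply: (mulfI (lt0r_neq0 Ya_gt0)).
  by rewrite mulrCA Ya mulrCA -XYa; ring.
have qr0 : 0 < q + r by exact: ltr_wpDr.
have tXE : tail P X a = q / (q + r) * tail P X s.
  apply: (mulfI (lt0r_neq0 qr0)); rewrite mulrA mulrCA divff ?gt_eqF// mulr1.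
  by rewrite mulrDl rF tX; ring.
by split=> //; rewrite mulrBl mul1r -tXE tX addrK.
Qed.

End AtomStep.

(** * Independence of time and cause with ties yields geometric laws *)

Section GeometricFromTimeCause.
Context d (T : measurableType d) (R : realType) (P : probability T R).
Variables X Y : T -> \bar R.
Hypotheses (mX : measurable_fun setT X) (mY : measurable_fun setT Y).
Hypotheses (fX : as_finite P X) (fY : as_finite P Y).
Hypothesis indep : independent_rv P X Y.
Hypothesis tci : time_cause_independent P X Y.
Local Notation Z := (rv_min X Y).
Local Notation p := (pr P [set w | (X w < Y w)%E]).
Local Notation q := (pr P [set w | (Y w < X w)%E]).
Local Notation r := (pr P [set w | X w = Y w]).
Hypotheses (p_gt0 : 0 < p) (q_gt0 : 0 < q) (r_gt0 : 0 < r).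

Let mZ : measurable_fun setT Z. Proof. by event_measurable. Qed.
Let fZ : as_finite P Z. Proof. exact: as_finite_rv_min. Qed.
Let indepC := independent_rvC indep.
Let tciC := time_cause_independentC tci.
(** The factor by which the tail of [Z] shrinks at each atom. *)
Let kappa : R := (q / (q + r)) * (p / (p + r)).

Let pqr1 : p + q + r = 1.
Proof.
by have := pr_trichotomy P mX mY measurableT; rewrite !setTI pr_setT.
Qed.

Let kappaE : kappa = p * q / (p * q + r).
Proof.
have -> : p * q + r = (q + r) * (p + r).
  by rewrite -[X in _ + X]mul1r -[X in X * r]pqr1; ring.
by rewrite /kappa; field; rewrite !gt_eqF ?addr_gt0.
Qed.

Let kappa_gt0 : 0 < kappa.
Proof. by rewrite kappaE divr_gt0 ?addr_gt0 ?mulr_gt0. Qed.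

Let kappa_lt1 : kappa < 1.
Proof. by rewrite kappaE ltr_pdivrMr ?addr_gt0 ?mulr_gt0// mul1r ltrDl. Qed.

(** Let [m], [n], [z] be the drops of the tails of [X], [Y], [Z], and [F], [G] the tails of [X], [Y]
    at [t]. Then [r z <= m n], [G m <= p z] and [F n <= q z] multiply to [r F G z <= p q z ^ 2], and
    [z > 0] cancels. *)
Let tail_gap (s t : \bar R) : (s <= t)%E ->
  tail P Z t < tail P Z s -> tail P Z t <= kappa * tail P Z s.
Proof.
move=> st Zst.
have pq0 : 0 < p * q + r by rewrite addr_gt0 ?mulr_gt0.
rewrite kappaE mulrAC ler_pdivlMr//.
have := tail_drop_le mX mY indep tci st.
have := tail_drop_le mY mX indepC tciC st; rewrite -rv_minC.
have := tail_drop_mul_ge mX mY indep tci st.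
rewrite -subr_gt0 in Zst; rewrite tail_rv_min// in Zst *.
have FX := le_tail P mX st; have GY := le_tail P mY st.
have := tail_ge0 P X t; have := tail_ge0 P Y t.
rewrite -subr_ge0 in FX; rewrite -subr_ge0 in GY.
move: Zst FX GY; rewrite tail_rv_min//.
set F := tail P X t; set G := tail P Y t.
set F' := tail P X s; set G' := tail P Y s.
set z := F' * G' - F * G => z0; set m := F' - F; set n := G' - G.
move=> m0 n0 G0 F0 rz Fn Gm.
suff : r * (F * G) <= p * q * z by rewrite /z; lra.
rewrite -(ler_pM2r z0).
apply: (@le_trans _ _ ((m * n) * (F * G))).
  by rewrite mulrAC ler_wpM2r// mulr_ge0.
have -> : m * n * (F * G) = (G * m) * (F * n) by ring.
have -> : p * q * z * z = (p * z) * (q * z) by ring.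
by apply: ler_pM => //; rewrite mulr_ge0.
Qed.

Let next (s : \bar R) : \bar R := (upper_quantile P Z (kappa * tail P Z s))%:E.

(** Between [s] and the quantile the tail exceeds [kappa * tail P Z s], so by [tail_gap] it has not
    dropped at all; at the quantile it is at most that level, which forces an atom. *)
Let nextP (s : \bar R) : 0 < tail P Z s ->
  [/\ (s < next s)%E, pr P [set w | (s < Z w)%E /\ (Z w < next s)%E] = 0 &
      0 < pr P [set w | Z w = next s]].
Proof.
move=> s0; rewrite /next; set u := kappa * _; set a := upper_quantile _ _ _.
have u01 : 0 < u < 1.
  apply/andP; split; first exact: mulr_gt0.
  apply: le_lt_trans kappa_lt1; apply: ler_piMr; first exact: ltW.
  exact: tail_le1.
have us : u < tail P Z s by rewrite /u gtr_pMl.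
have aE t : (a <= t) = (tail P Z t%:E <= u) by rewrite upper_quantile_le.
have au : tail P Z a%:E <= u by rewrite -aE.
have sa : (s < a%:E)%E.
  rewrite ltNge; apply/negP => as'; have := le_tail P mZ as'.
  by rewrite leNgt (le_lt_trans au us).
have ge_a : tail P Z s <= pr P [set w | (a%:E <= Z w)%E].
  apply: tail_left_le => // t ta; have [ts|/ltW st] := leP t%:E s.
    exact: le_tail.
  rewrite leNgt; apply/negP => /(tail_gap st); rewrite -/u -aE.
  by rewrite leNgt ta.
have oo := pr_itv_oo P mZ sa.
split=> //.
- by apply/eqP; rewrite eq_le pr_ge0 andbT oo subr_le0.
- by have := pr_ge_tail P mZ a%:E => Za; lra.
Qed.

(** The start [b 0 = -oo] is a point where the tails are 1, not an atom; the atoms are [b 1], [b 2]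
    and so on. *)
Let b k : \bar R := iter k next -oo%E.

Let step (s : \bar R) : 0 < tail P Z s ->
  [/\ tail P X (next s) = q / (q + r) * tail P X s,
      tail P Y (next s) = p / (p + r) * tail P Y s,
      pr P [set w | X w = next s] = (1 - q / (q + r)) * tail P X s &
      pr P [set w | Y w = next s] = (1 - p / (p + r)) * tail P Y s].
Proof.
move=> s0; have [ss Zss Zs] := nextP s0.
have [X1 X2] := next_atom_tail mX mY indep tci p_gt0 q_gt0 ss Zss Zs.
rewrite (rv_minC X) in Zss Zs.
have [] := next_atom_tail mY mX indepC tciC q_gt0 p_gt0 ss Zss Zs.
by rewrite (event_eqC Y).
Qed.

Let tails_b k : tail P X (b k) = (q / (q + r)) ^+ k /\
                tail P Y (b k) = (p / (p + r)) ^+ k.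
Proof.
elim: k => [|k [IX IY]]; first by rewrite !expr0 /b /= !tailNy.
have Zk : 0 < tail P Z (b k).
  by rewrite tail_rv_min// IX IY mulr_gt0// exprn_gt0// divr_gt0// addr_gt0.
have [X1 Y1 _ _] := step Zk.
by rewrite /b iterS -/(b k) X1 Y1 IX IY -!exprS.
Qed.

Let tail_b_gt0 k : 0 < tail P Z (b k).
Proof.
have [IX IY] := tails_b k.
by rewrite tail_rv_min// IX IY mulr_gt0// exprn_gt0// divr_gt0// addr_gt0.
Qed.

Lemma geometric_of_time_cause_independent :
  exists g : R -> R, strictly_increasing_pos g /\
    g_geometric P g X /\ g_geometric P g Y.
Proof.
(* Only the values of [g] at [1, 2, ...] matter for the laws; as the interpolation starts at 0,
   [a 0] is a filler one unit below the first atom. *)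
pose a k := if k is k'.+1 then upper_quantile P Z (kappa * tail P Z (b k'))
            else upper_quantile P Z (kappa * tail P Z (b 0)) - 1.
have ab k : (a k.+1)%:E = b k.+1 by [].
have a_incr k : a k < a k.+1.
  case: k => [|k]; first by rewrite /a ltrBlDr ltrDl.
  rewrite -lte_fin !ab /b (iterS k.+1).
  by have [] := nextP (tail_b_gt0 k.+1).
have [g g_incr ga] := increasing_interpolation a_incr.
have alpha01 x : 0 < x -> 0 < 1 - x / (x + r) < 1.
  move=> x0; have xr : 0 < x + r by exact: addr_gt0.
  rewrite subr_gt0 ltr_pdivrMr// mul1r ltrDl r_gt0/=.
  by rewrite ltrBlDr ltrDl divr_gt0.
exists g; split=> //; split; apply/g_geometricP => //.
- exists (1 - q / (q + r)); first exact: alpha01.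
  move=> k; rewrite ga ab subKr; have [<- _] := tails_b k.
  by have [_ _ + _] := step (tail_b_gt0 k).
- exists (1 - p / (p + r)); first exact: alpha01.
  move=> k; rewrite ga ab subKr; have [_ <-] := tails_b k.
  by have [_ _ _] := step (tail_b_gt0 k).
Qed.

End GeometricFromTimeCause.

(** * Minimum of exponential laws and assembly of the equivalence *)

Lemma g_exponential_rv_min d (T : measurableType d) (R : realType)
    (P : probability T R) (g : R -> R) (X Y : T -> \bar R) :
  strictly_increasing_pos g ->
  measurable_fun setT X -> measurable_fun setT Y -> independent_rv P X Y ->
  g_exponential P g X -> g_exponential P g Y -> g_exponential P g (rv_min X Y).
Proof.
move=> g_incr mX mY indep [lambda l0 XE] [mu m0 YE].
apply: (@g_exponential_of_tail _ _ _ _ _ _ g_incr _ (lambda + mu));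
  [by event_measurable|exact: addr_gt0|move=> t].
rewrite tail_rv_min// EFinM (tail_g_exponential mX t%:E XE)
  (tail_g_exponential mY t%:E YE).
(* The point [u] is common to all rates, so multiplying the tails adds the rates. *)
have [E|[u u0 E]] := image_law_tail t g_incr; rewrite !E ?addr_gt0//.
  by rewrite mul0e.
by rewrite -EFinM -expRD; congr (expR _)%:E; ring.
Qed.

(** Ties have probability 0, and the two strict orders are exchanged by symmetry. *)
Lemma exponential_time_cause_independent d (T : measurableType d)
    (R : realType) (P : probability T R) (g : R -> R) (X Y : T -> \bar R) :
  strictly_increasing_pos g ->
  measurable_fun setT X -> measurable_fun setT Y -> independent_rv P X Y ->
  g_exponential P g X -> g_exponential P g Y ->
  pr P [set w | X w = Y w] = 0 -> time_cause_independent P X Y.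
Proof.
move=> g_incr mX mY indep XE YE XY0.
have mZ : measurable_fun setT (rv_min X Y) by event_measurable.
split; apply: indep_of_event_pr => //; try by event_measurable.
- move=> t; rewrite rv_minC; apply: (exponential_cause_indep g_incr) => //.
    exact: independent_rvC.
  by rewrite event_eqC.
- by move=> t; exact: (exponential_cause_indep g_incr).
- move=> t; rewrite XY0 mulr0.
  apply/eqP; rewrite eq_le pr_ge0 andbT -[leRHS]XY0.
  by apply: le_pr => [| |w []//]; event_measurable.
Qed.

Local Open Scope ereal_scope.

Theorem theorem1 (R : realType) (d : measure_display) (T : measurableType d)
  (P : probability T R) (X Y : {RV P >-> \bar R})
  (hindep : independent_rv P X Y)
  (hX : as_finite P X) (hY : as_finite P Y)
  (hp : 0 < P [set w | X w < Y w])
  (hq : 0 < P [set w | X w > Y w]) :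
  let r := P [set w | X w = Y w] in
  (time_cause_independent P X Y <->
    exists g : R -> R, strictly_increasing_pos g /\
      ((r = 0 /\ g_exponential P g X /\ g_exponential P g Y) \/
       (0 < r /\ g_geometric P g X /\ g_geometric P g Y)))
  /\
  (forall g : R -> R, strictly_increasing_pos g ->
     (r = 0 -> g_exponential P g X -> g_exponential P g Y ->
        g_exponential P g (rv_min X Y)) /\
     (0 < r -> g_geometric P g X -> g_geometric P g Y ->
        g_geometric P g (rv_min X Y))).
Proof.
move=> r.
have mX : measurable_fun setT X by exact: measurable_funPT.
have mY : measurable_fun setT Y by exact: measurable_funPT.
have rE : r = (pr P [set w | X w = Y w])%:E by rewrite -prE//; event_measurable.
split; last first.
  move=> g g_incr; split=> _ XG YG; first exact: g_exponential_rv_min.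
  exact: g_geometric_rv_min.
have p0 : (0 < pr P [set w | (X w < Y w)%E])%R.
  by rewrite -lte_fin -prE//; event_measurable.
have q0 : (0 < pr P [set w | (Y w < X w)%E])%R.
  by rewrite -lte_fin -prE//; event_measurable.
split=> [tci|[g [g_incr [[r0 [XE YE]]|[_ [XG YG]]]]]].
(* Whether [r] vanishes decides between the atomless and the atomic case. *)
- have : 0 <= r by rewrite rE lee_fin pr_ge0.
  rewrite le_eqVlt => /predU1P[r0|r0].
    have [|g [g_incr XYE]] :=
      exponential_of_time_cause_independent mX mY hX hY hindep tci p0 q0.
      by apply: EFin_inj; rewrite -rE -r0.
    by exists g; split=> //; left.
  have [|g [g_incr XYG]] :=
    geometric_of_time_cause_independent mX mY hX hY hindep tci p0 q0.
    by rewrite -lte_fin -rE.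
  by exists g; split=> //; right.
- apply: (exponential_time_cause_independent g_incr) => //.
  by apply: EFin_inj; rewrite -rE.
- exact: (geometric_time_cause_independent g_incr).
Qed.
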